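(* Let $\mathbb{G}$ be a Carnot group. Then for every $\alpha\in(0,\dim_e\mathbb{G}]$ there exists a compact set $K\subset\mathbb{G}$ with $$0<\mathcal{H}_e^{\alpha}(K)\qquad\text{and}\qquad\mathcal{H}_{cc}^{\beta_-(\alpha)}(K)<\infty.$$
   Context: Let $(\mathbb{G},* )$ be a step $s$ Carnot group, i.e. a connected, simply connected Lie group whose (finite-dimensional real) Lie algebra is stratified: $\mathfrak{g}=\mathfrak{v}_1\oplus\cdots\oplus\mathfrak{v}_s$ with $[\mathfrak{v}_1,\mathfrak{v}_j]=\mathfrak{v}_{j+1}$ for $j=1,\dots,s-1$ and $[\mathfrak{v}_1,\mathfrak{v}_s]=0$. Put $m_j=\dim\mathfrak{v}_j$. Fix a graded orthonormal basis $\{E_{jk}:1\le j\le s,\ 1\le k\le m_j\}$ of $\mathfrak{g}$ (with $E_{jk}\in\mathfrak{v}_j$). Via the exponential coordinates $(x_1,\dots,x_s)\in\mathbb{R}^{m_1}\times\cdots\times\mathbb{R}^{m_s}\mapsto\exp\left(\sum_{j=1}^s\sum_{k=1}^{m_j}\langle x_j,e_{jk}\rangle E_{jk}\right)$, where $\{e_{jk}\}_{k}$ is the standard basis of $\mathbb{R}^{m_j}$, $\mathbb{G}$ is identified with $\mathbb{R}^{m_1+\cdots+m_s}$ equipped with the corresponding group operation. $d_e$ is the Euclidean metric in these coordinates, and $d_{cc}$ is the Carnot–Carathéodory metric: $d_{cc}(p,q)$ is the infimum of the lengths of horizontal curves joining $p$ to $q$, i.e. absolutely continuous curves tangent almost everywhere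 to the left-invariant subbundle generated by $\mathfrak{v}_1$, with length measured by the left-invariant inner product on it for which $E_{11},\dots,E_{1m_1}$ are orthonormal. $\mathcal{H}_e^a$ and $\mathcal{H}_{cc}^a$ denote the $a$-dimensional Hausdorff measures with respect to $d_e$ and $d_{cc}$. $\dim_e\mathbb{G}=\sum_{j=1}^sm_j$ is the Euclidean (topological) dimension of $\mathbb{G}$. The lower dimension comparison function of $\mathbb{G}$ is, for $\alpha\in(0,\sum_{j=1}^sm_j]$, $$\beta_-(\alpha)=\sum_{j=1}^{l_-}jm_j+(1+l_-)\left(\alpha-\sum_{j=1}^{l_-}m_j\right),$$ where $l_-\in\{0,\dots,s-1\}$ is determined by $\sum_{j=1}^{l_-}m_j<\alpha\le\sum_{j=1}^{1+l_-}m_j$. *)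

(* Defs.v *)
From HB Require Import structures.
From mathcomp Require Import all_boot all_order all_algebra.
From mathcomp Require Import all_classical all_reals all_analysis.

Set Implicit Arguments.
Unset Strict Implicit.
Unset Printing Implicit Defensive.

Import Order.TTheory GRing.Theory Num.Theory.
Import numFieldNormedType.Exports.

Local Open Scope classical_set_scope.
Local Open Scope ring_scope.

(* Distances take values in [\bar R]: a Carnot-Caratheodory distance is defined
   as an infimum, whose finiteness is a theorem.                              *)
Section Hausdorff.
Context (R : realType) (T : Type) (d : T -> T -> \bar R).

(* -oo for the empty set *)
Definition diam (A : set T) : \bar R :=
  ereal_sup [set d p.1 p.2 | p in A `*` A].

Definition hausdorff_weight (a : R) (A : set T) : \bar R :=
  if A == set0 then 0%E else (diam A `^ a)%E.

Definition hausdorff_premeasure (a delta : R) (A : set T) : \bar R :=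
  ereal_inf [set (\sum_(0 <= k <oo) hausdorff_weight a (U k))%E
            | U in [set U : nat -> set T |
                A `<=` \bigcup_k U k /\ forall k, (diam (U k) <= delta%:E)%E]].

(* Not normalised: constant multiples are irrelevant here. *)
Definition hausdorff_measure (a : R) (A : set T) : \bar R :=
  ereal_sup [set hausdorff_premeasure a delta A
            | delta in [set delta | 0 < delta]].

End Hausdorff.

(* Norms on ['rV_n] are sup norms in the library; the choice of the norm does
   not affect the notion.                                                     *)
Definition absolutely_continuous (R : realType) (V : normedModType R)
    (a b : R) (f : R -> V) : Prop :=
  forall e : R, 0 < e -> exists2 delta : R, 0 < delta &
    forall (n : nat) (u v : 'I_n -> R),
      (forall i, a <= u i /\ u i <= v i /\ v i <= b) ->
      (forall i j, i != j -> v i <= u j \/ v j <= u i) ->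
      \sum_i (v i - u i) < delta -> \sum_i `|f (v i) - f (u i)| < e.

(* The Baker-Campbell-Hausdorff product of a Lie bracket in which all brackets
   of more than r elements vanish, in Dynkin's form
     x * y = sum_(k >= 1) (-1)^(k-1) / k
               sum_(p_1 + q_1 > 0, ..., p_k + q_k > 0)
                 [x^p_1 y^q_1 ... x^p_k y^q_k]
                   / (sum_i (p_i + q_i) * prod_i p_i! q_i!),
   where [w_1 ... w_l] = [w_1, [w_2, ... [w_(l-1), w_l]]].  Only terms with
   k <= r and p_i, q_i <= r can be nonzero.                                   *)
Section BCH.
Context (R : realType) (V : lmodType R) (br : V -> V -> V).

Fixpoint nested_bracket (w : seq V) : V :=
  match w with
  | [::] => 0
  | [:: u] => u
  | u :: w' => br u (nested_bracket w')
  end.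

Definition dynkin_word (r k : nat) (f : {ffun 'I_k -> 'I_r.+1 * 'I_r.+1})
    (x y : V) : seq V :=
  flatten [seq nseq (f i).1 x ++ nseq (f i).2 y | i <- enum 'I_k].

Definition bch (r : nat) (x y : V) : V :=
  \sum_(1 <= k < r.+1)
    \sum_(f : {ffun 'I_k -> 'I_r.+1 * 'I_r.+1}
          | [forall i, 0 < (f i).1 + (f i).2]%N)
      ((-1) ^+ k.-1
        / (k * (\sum_i ((f i).1 + (f i).2)) * \prod_i ((f i).1`! * (f i).2`!))%:R)
      *: nested_bracket (dynkin_word f x y).

End BCH.

(* Layers are numbered from 0: a group of step s.+1 has layers v_(j+1),
   j : 'I_s.+1, of dimensions m j. *)
Definition edim (s : nat) (m : 'I_s.+1 -> nat) : nat := (\sum_j m j)%N.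

(* R^(m_1) x ... x R^(m_(s+1)), i.e. the Lie algebra in a graded orthonormal
   basis and the group in exponential coordinates.                            *)
Notation coords R m := 'rV[R]_(\sum_j m j)%N.

Section Layers.
Context (R : realType) (s : nat) (m : 'I_s.+1 -> nat).

Definition basis_vector (j : 'I_s.+1) (k : 'I_(m j)) : coords R m :=
  delta_mx 0 (tagnat.Rank j k).

Definition layer (j : 'I_s.+1) : {vspace coords R m} :=
  <<[seq basis_vector k | k <- enum 'I_(m j)]>>%VS.

(* [U, W], the linear span of all [u, w] (br is meant to be bilinear) *)
Definition bracket_space (br : coords R m -> coords R m -> coords R m)
    (U W : {vspace coords R m}) : {vspace coords R m} :=
  <<[seq br u w | u <- vbasis U, w <- vbasis W]>>%VS.

End Layers.

(* Being in exponential coordinates means that exp is the identity map, so that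
   the group law is the Baker-Campbell-Hausdorff product; the identity is 0 and
   the inverse is -x.  The law being polynomial, smoothness is automatic.      *)
Record carnot_group (R : realType) (s : nat) (m : 'I_s.+1 -> nat) :=
CarnotGroup {
  law : coords R m -> coords R m -> coords R m;
  bracket : coords R m -> coords R m -> coords R m;
  lawA : associative law;
  law0x : left_id 0 law;
  lawx0 : right_id 0 law;
  lawNx : left_inverse 0 -%R law;
  lawxN : right_inverse 0 -%R law;
  bracket_linearl : forall y, linear (bracket^~ y);
  bracket_linearr : forall x, linear (bracket x);
  bracketxx : forall x, bracket x x = 0;
  bracket_jacobi : forall x y z,
    bracket x (bracket y z) + bracket y (bracket z x)
      + bracket z (bracket x y) = 0;
  layer_gt0 : forall j, (0 < m j)%N;
  bracket_layer : forall i j : 'I_s.+1, j = i.+1 :> nat ->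
    bracket_space bracket (layer R m ord0) (layer R m i) = layer R m j;
  bracket_last :
    bracket_space bracket (layer R m ord0) (layer R m ord_max) = 0%VS;
  lawE : forall x y, law x y = bch bracket s.+1 x y
}.

Section Metrics.
Context (R : realType) (s : nat) (m : 'I_s.+1 -> nat) (G : carnot_group R m).
Local Notation V := (coords R m).

Definition euclidean_dist (x y : V) : \bar R :=
  (Num.sqrt (\sum_i (x 0 i - y 0 i) ^+ 2))%:E.

(* The left-invariant vector field with value v at the identity. *)
Definition left_field (v p : V) : V := 'D_v (law G p) 0.

Definition horizontal_frame (p : V) : (m ord0).-tuple V :=
  [tuple left_field (basis_vector R k) p | k < m ord0].

(* The norm for which the horizontal frame is orthonormal; only meaningful on
   horizontal vectors.                                                        *)
Definition horizontal_norm (p v : V) : R :=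
  Num.sqrt (\sum_k (coord (horizontal_frame p) k v) ^+ 2).

Definition horizontal_curve (a b : R) (c : R -> V) : Prop :=
  [/\ a <= b, absolutely_continuous a b c &
      {ae (@lebesgue_measure R), forall t, t \in `[a, b] ->
         derivable c t 1 /\ derive1 c t \in <<horizontal_frame (c t)>>%VS}].

Definition horizontal_length (a b : R) (c : R -> V) : \bar R :=
  (\int[@lebesgue_measure R]_(t in `[a, b])
     (horizontal_norm (c t) (derive1 c t))%:E)%E.

Definition cc_dist (p q : V) : \bar R :=
  ereal_inf [set L | exists a b c, [/\ horizontal_curve a b c,
    c a = p, c b = q & L = horizontal_length a b c]].

End Metrics.

Section Dimension_comparison.
Context (R : realType) (s : nat) (m : 'I_s.+1 -> nat).

(* m_1 + ... + m_l *)
Definition dim_upto (l : nat) : nat := (\sum_(j < s.+1 | (j < l)%N) m j)%N.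

(* m_1 + 2 m_2 + ... + l m_l *)
Definition hdim_upto (l : nat) : nat :=
  (\sum_(j < s.+1 | (j < l)%N) j.+1 * m j)%N.

(* The default value 0 is not reached for 0 < alpha <= edim m. *)
Definition beta_minus (alpha : R) : R :=
  if [pick l : 'I_s.+1 | ((dim_upto l)%:R < alpha)
                         && (alpha <= (dim_upto l.+1)%:R)] is Some l
  then (hdim_upto l)%:R + (1 + l%:R) * (alpha - (dim_upto l)%:R)
  else 0.

End Dimension_comparison.

(* Main.v *)
(* A coordinate of the layer v_j is written in base 2^j, so that the k-th digits
   of all the coordinates form a vector a_k with dilation_(2^k) a_k bounded, and
   K is the closure of the set of ordered products a_0 * a_1 * ... * a_(n-1).
   In coordinate i, of weight w_i, only a proportion gamma_i of the binary digits
   is free; the gamma_i in [0, 1] are filled greedily in increasing order of the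
   weights, so that sum gamma_i = alpha and sum w_i gamma_i = beta_-(alpha).

   Upper bound: the first n factors determine a point of K up to a left translate
   of dilation_(2^-n) B with B bounded.  Such a translate has Carnot-Caratheodory
   diameter O(2^-n), because bounded elements are products of boundedly many
   bounded horizontal elements, and there are at most 2^(n beta_-) of them.

   Lower bound: by the Baker-Campbell-Hausdorff formula, a coordinate of the
   product is the number with the digits of that coordinate plus a function of
   the digits in the lower layers.  Hence, by induction on the layers, two
   products of n factors at distance < 2^-h with the same binary digits from
   position h on are equal.  A set of Euclidean diameter < 2^-h therefore contains
   a proportion O(2^(-h alpha)) of the products, and a mass distribution argument
   concludes.                                                                  *)

Require Import Defs.
From HB Require Import structures.
From mathcomp Require Import all_boot all_order all_algebra.
From mathcomp Require Import all_classical all_reals all_analysis.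
From mathcomp Require Import measurable_realfun.
From mathcomp Require Import zify ring lra.

Set Implicit Arguments.
Unset Strict Implicit.
Unset Printing Implicit Defensive.

Import Order.TTheory GRing.Theory Num.Theory.
Import numFieldNormedType.Exports.

Local Open Scope classical_set_scope.
Local Open Scope ring_scope.

(** * The Baker-Campbell-Hausdorff sum up to order two *)

Section Brackets.
Context (R : realType) (V : lmodType R) (br : V -> V -> V).

(** Unfolding from the inside: the innermost bracket has two letters of w, and every further letter
    acts by [br a]. *)
Lemma nested_bracket_closed (P : V -> Prop) (w : seq V) :
  {in w &, forall a b, P (br a b)} ->
  (forall a z, a \in w -> P z -> P (br a z)) ->
  (1 < size w)%N -> P (nested_bracket br w).
Proof.
elim: w => [//|a w ih] P2 Pbr sw.
case: w ih P2 Pbr sw => [//|b [|c w]] ih P2 Pbr _.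
  by apply: P2; rewrite !inE eqxx ?orbT.
apply: (Pbr); first by rewrite inE eqxx.
apply: ih => //.
- by move=> u v uw vw; apply: P2; rewrite inE ?uw ?vw orbT.
- by move=> u z uw; apply: Pbr; rewrite inE uw orbT.
Qed.

Definition letter (x y : V) (b : bool) : V := if b then y else x.

(** The words are coded by booleans, so that index sets and coefficients do not depend on x and y
    and two products can be compared term by term. *)
Definition dynkin_letters r k (f : {ffun 'I_k -> 'I_r.+1 * 'I_r.+1}) :
    seq bool :=
  flatten [seq nseq (f i).1 false ++ nseq (f i).2 true | i <- enum 'I_k].

Lemma dynkin_wordE r k (f : {ffun 'I_k -> 'I_r.+1 * 'I_r.+1}) x y :
  dynkin_word f x y = map (letter x y) (dynkin_letters f).
Proof.
rewrite /dynkin_word /dynkin_letters map_flatten -map_comp.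
by congr flatten; apply: eq_map => i /=; rewrite map_cat !map_nseq.
Qed.

Lemma size_dynkin_letters r k (f : {ffun 'I_k -> 'I_r.+1 * 'I_r.+1}) :
  size (dynkin_letters f) = (\sum_i ((f i).1 + (f i).2))%N.
Proof.
rewrite size_flatten /shape -map_comp sumnE big_map big_enum /=.
by apply: eq_bigr => i _; rewrite size_cat !size_nseq.
Qed.

Lemma dynkin_lettersN r k (f : {ffun 'I_k -> 'I_r.+1 * 'I_r.+1}) :
  [forall i, 0 < (f i).1 + (f i).2]%N -> (k <= size (dynkin_letters f))%N.
Proof.
move=> /forallP f0; rewrite size_dynkin_letters.
rewrite -[leqLHS](card_ord k) -sum1_card; apply: leq_sum => i _; exact: f0.
Qed.

Definition dynkin_coef r k (f : {ffun 'I_k -> 'I_r.+1 * 'I_r.+1}) : R :=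
  (-1) ^+ k.-1
  / (k * (\sum_i ((f i).1 + (f i).2)) * \prod_i ((f i).1`! * (f i).2`!))%:R.

(** The terms of the Baker-Campbell-Hausdorff sum whose word length satisfies P; [leq n] selects the
    words with at least n letters. *)
Definition bch_tail r (P : pred nat) x y : V :=
  \sum_(1 <= k < r.+1)
    \sum_(f : {ffun 'I_k -> 'I_r.+1 * 'I_r.+1}
          | [forall i, 0 < (f i).1 + (f i).2]%N && P (size (dynkin_letters f)))
      dynkin_coef f *: nested_bracket br (map (letter x y) (dynkin_letters f)).

Lemma bch_tailE r x y : bch br r x y = bch_tail r xpredT x y.
Proof.
rewrite /bch /bch_tail; apply: eq_bigr => k _; apply: eq_big => [f|f _].
  by rewrite andbT.
by rewrite dynkin_wordE.
Qed.

Lemma bch_tail_split r (P Q : pred nat) x y :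
  bch_tail r P x y =
  bch_tail r (predI P Q) x y + bch_tail r (predI P (predC Q)) x y.
Proof.
rewrite /bch_tail -big_split /=; apply: eq_bigr => k _.
rewrite (bigID (fun f => Q (size (dynkin_letters f)))) /=.
by congr (_ + _); apply: eq_bigl => f; rewrite -andbA.
Qed.

Lemma big_ffun1 (T : finType) (P : pred {ffun 'I_1 -> T})
    (F : {ffun 'I_1 -> T} -> V) :
  \sum_(f | P f) F f = \sum_(a | P [ffun=> a]) F [ffun=> a].
Proof.
rewrite (reindex (fun a : T => [ffun _ : 'I_1 => a])) //=.
apply: onW_bij; exists (fun f : {ffun 'I_1 -> T} => f ord0) => [a|f].
  by rewrite ffunE.
by apply/ffunP => i; rewrite ffunE (ord1 i).
Qed.

Lemma dynkin_letters1 r (a : 'I_r.+1 * 'I_r.+1) :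
  dynkin_letters [ffun _ : 'I_1 => a] = nseq a.1 false ++ nseq a.2 true.
Proof. by rewrite /dynkin_letters enum_ordSl enum_ord0 /= ffunE cats0. Qed.

Lemma dynkin_coef1 r (a : 'I_r.+1 * 'I_r.+1) :
  dynkin_coef [ffun _ : 'I_1 => a] = ((a.1 + a.2) * (a.1`! * a.2`!))%:R^-1.
Proof.
by rewrite /dynkin_coef !big_ord1 !ffunE expr0 mul1r mul1n.
Qed.

Lemma bch_tail_small r n (P : pred nat) x y : (n <= r)%N ->
    (forall l, P l -> (l <= n)%N) ->
  bch_tail r P x y = \sum_(1 <= k < n.+1)
    \sum_(f : {ffun 'I_k -> 'I_r.+1 * 'I_r.+1}
          | [forall i, 0 < (f i).1 + (f i).2]%N && P (size (dynkin_letters f)))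
      dynkin_coef f *: nested_bracket br (map (letter x y) (dynkin_letters f)).
Proof.
move=> nr Pn; rewrite /bch_tail (big_cat_nat _ (n := n.+1)) //=.
rewrite [X in _ + X]big_nat_cond [X in _ + X]big1 ?addr0 //.
move=> k /andP[/andP[nk _] _].
rewrite big_pred0 // => f; apply/negbTE/negP => /andP[f0 /Pn].
by move=> /(leq_trans (dynkin_lettersN f0)); rewrite leqNgt nk.
Qed.

Lemma bch_tail1 r x y : (0 < r)%N -> bch_tail r (pred1 1%N) x y = x + y.
Proof.
case: r => // r _; rewrite (bch_tail_small (n := 1)) //; last by move=> l /eqP ->.
rewrite big_nat1 big_ffun1.
rewrite (bigD1 (inord 1, inord 0)) /=; last first.
  rewrite dynkin_letters1 size_cat !size_nseq /= !inordK // eqxx andbT.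
  by apply/forallP => i; rewrite ffunE /= !inordK.
rewrite (bigD1 (inord 0, inord 1)) /=; last first.
  rewrite dynkin_letters1 size_cat !size_nseq /= !inordK // eqxx andbT.
  rewrite xpair_eqE /= -!val_eqE /= !inordK //= andbT.
  by apply/forallP => i; rewrite ffunE /= !inordK.
rewrite big1 ?addr0 => [|[a1 a2] /andP[/andP[/andP[_]]]].
  rewrite !dynkin_letters1 !dynkin_coef1 /= !inordK //=.
  by rewrite invr1 !scale1r.
rewrite dynkin_letters1 size_cat !size_nseq !xpair_eqE /=.
rewrite -!val_eqE /= !inordK //.
by case: (a1 : nat) (a2 : nat) => [|[|?]] [|[|?]].
Qed.

Context (brxx : forall x, br x x = 0)
  (br_antisym : forall x y, br x y = - br y x).

(** Words with two equal letters vanish. For k = 1 the word x y has coefficient 1/2; for k = 2 the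
    words x y and y x have the same coefficient, and their brackets cancel. *)
Lemma bch_tail2 r x y : (0 < r)%N ->
  bch_tail r (pred1 2%N) x y = 2^-1 *: br x y.
Proof.
case: r => // r _.
have sum1 : \sum_(f : {ffun 'I_1 -> 'I_r.+2 * 'I_r.+2}
      | [forall i, 0 < (f i).1 + (f i).2]%N && (size (dynkin_letters f) == 2))
      dynkin_coef f *: nested_bracket br (map (letter x y) (dynkin_letters f))
    = 2^-1 *: br x y.
  rewrite big_ffun1 (bigD1 (inord 1, inord 1)) /=; last first.
    rewrite dynkin_letters1 size_cat !size_nseq /= !inordK // eqxx andbT.
    by apply/forallP => i; rewrite ffunE /= !inordK.
  rewrite big1 ?addr0 => [|[a1 a2] /andP[/andP[_]]].
    by rewrite !dynkin_letters1 !dynkin_coef1 /= !inordK.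
  rewrite dynkin_letters1 size_cat !size_nseq !xpair_eqE /=.
  rewrite -!val_eqE /= !inordK //.
  by case: (a1 : nat) (a2 : nat) => [|[|[|?]]] [|[|[|?]]] //= _ _;
    rewrite brxx scaler0.
(* In step one the sum over k stops at k = 1. *)
case: r sum1 => [|r] sum1.
  rewrite /bch_tail big_nat1; exact: sum1.
rewrite (bch_tail_small (n := 2)) //; last by move=> l /eqP ->.
rewrite big_nat_recl // big_nat1 sum1.
set S := (X in _ + X); suff -> : S = 0 by rewrite addr0.
suff : S = - S by move/eqP; rewrite -addr_eq0 -mulr2n -scaler_nat scaler_eq0
  pnatr_eq0 /= => /eqP.
(* Exchanging x and y changes the sign of the bracket of two letters. *)
pose sw (f : {ffun 'I_2 -> 'I_r.+3 * 'I_r.+3}) := [ffun i => ((f i).2, (f i).1)].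
have swK : involutive sw.
  by move=> f; apply/ffunP => i; rewrite !ffunE /=; case: (f i).
have sz_sw f : size (dynkin_letters (sw f)) = size (dynkin_letters f).
  by rewrite !size_dynkin_letters; apply: eq_bigr => i _; rewrite ffunE /= addnC.
rewrite {1}/S (reindex_inj (inv_inj swK)) /= /S -sumrN.
apply: eq_big => [f|f /andP[/forallP fgt0]].
  rewrite sz_sw; congr (_ && _); apply/eq_forallb => i.
  by rewrite ffunE /= addnC.
rewrite sz_sw => /eqP szf.
have -> : dynkin_coef (sw f) = dynkin_coef f.
  rewrite /dynkin_coef; congr (_ / (_ * _ * _)%:R).
    by apply: eq_bigr => i _; rewrite ffunE /= addnC.
  by apply: eq_bigr => i _; rewrite ffunE /= mulnC.
rewrite -scalerN; congr (_ *: _).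
move: szf (fgt0 ord0) (fgt0 ord_max); rewrite size_dynkin_letters.
rewrite !big_ord_recl big_ord0 /dynkin_letters !enum_ordSl enum_ord0 /= !ffunE /=.
have -> : lift ord0 ord0 = ord_max :> 'I_2 by apply: val_inj.
case: (f ord0) => [[[|[|?]] ?] [[|[|?]] ?]] /=;
  case: (f ord_max) => [[[|[|?]] ?] [[|[|?]] ?]] //= *;
  first [by rewrite ?brxx ?oppr0 // /letter; exact: br_antisym | lia].
Qed.

(** Empty words do not occur, since k >= 1 and the blocks are nonempty; a word that is not a single
    letter therefore has at least two. *)
Lemma bch_split2 r x y : (0 < r)%N ->
  bch br r x y = x + y + bch_tail r (leq 2) x y.
Proof.
move=> r0; rewrite bch_tailE (bch_tail_split _ _ (pred1 1%N)) -(bch_tail1 x y r0).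
rewrite /bch_tail; congr (_ + _); rewrite !big_nat; apply: eq_bigr => k /andP[k0 _].
apply: eq_bigl => f; case: (boolP [forall _, _]) => //= /dynkin_lettersN.
by move=> /(leq_trans k0); case: size => [|[|]].
Qed.

Lemma bch_split3 r x y : (0 < r)%N ->
  bch_tail r (leq 2) x y = 2^-1 *: br x y + bch_tail r (leq 3) x y.
Proof.
move=> r0; rewrite (bch_tail_split _ _ (pred1 2%N)) -(bch_tail2 x y r0).
rewrite /bch_tail; congr (_ + _); rewrite !big_nat; apply: eq_bigr => k /andP[k0 _];
  by apply: eq_bigl => f; case: (boolP [forall _, _]) => //=;
    case: size => [|[|[|]]].
Qed.

End Brackets.

(** * Grading and dilations *)

Section Grading.
Context (R : realType) (s : nat) (m : 'I_s.+1 -> nat).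
Local Notation V := (coords R m).
Local Notation index := 'I_(\sum_j m j).

(** Layers are counted from 0, so that the coordinate i has degree [(weight i).+1] under
    dilations. *)
Definition weight (i : index) : nat := tagnat.sig1 i.

Lemma weight_le i : (weight i <= s)%N.
Proof. by rewrite /weight -ltnS. Qed.

(* Layers are numbered from 0: x lies in the span of the layers of index >= j. *)
Definition filtered (j : nat) (x : V) : Prop :=
  forall i : index, (weight i < j)%N -> x 0 i = 0.

(** The layer k in coordinates, see [mem_layer]; here k may be any natural number, and for k > s
    only the vector 0 qualifies. *)
Definition homogeneous (k : nat) (x : V) : Prop :=
  forall i : index, weight i != k -> x 0 i = 0.

Lemma filtered0 x : filtered 0 x. Proof. by []. Qed.

Lemma filteredz j : filtered j 0. Proof. by move=> i _; rewrite mxE. Qed.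

Lemma filteredD j x y : filtered j x -> filtered j y -> filtered j (x + y).
Proof. by move=> xj yj i ij; rewrite mxE xj ?yj ?addr0. Qed.

Lemma filteredZ j a x : filtered j x -> filtered j (a *: x).
Proof. by move=> xj i ij; rewrite mxE xj ?mulr0. Qed.

Lemma filteredN j x : filtered j x -> filtered j (- x).
Proof. by move=> xj i ij; rewrite mxE xj ?oppr0. Qed.

Lemma filteredB j x y : filtered j x -> filtered j y -> filtered j (x - y).
Proof. by move=> xj yj; apply/filteredD/filteredN. Qed.

Lemma filtered_sum j (I : Type) (r : seq I) (P : pred I) (F : I -> V) :
  (forall i, P i -> filtered j (F i)) -> filtered j (\sum_(i <- r | P i) F i).
Proof.
move=> PF; apply: (big_ind (filtered j)) => //; first exact: filteredz.
exact: filteredD.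
Qed.

Lemma filtered_leq j k x : (j <= k)%N -> filtered k x -> filtered j x.
Proof. by move=> jk xk i ij; apply: xk; exact: leq_trans jk. Qed.

Lemma filtered_gt j x : (s < j)%N -> filtered j x -> x = 0.
Proof.
move=> sj xj; apply/rowP => i; rewrite mxE; apply: xj.
exact: leq_ltn_trans (weight_le i) sj.
Qed.

Lemma homogeneous_filtered k x : homogeneous k x -> filtered k x.
Proof. by move=> xk i ik; apply: xk; rewrite neq_ltn ik. Qed.

Lemma homogeneousz k : homogeneous k 0.
Proof. by move=> i _; rewrite mxE. Qed.

Lemma homogeneousD k x y :
  homogeneous k x -> homogeneous k y -> homogeneous k (x + y).
Proof. by move=> xk yk i ik; rewrite mxE xk ?yk ?addr0. Qed.

Lemma homogeneousZ k a x : homogeneous k x -> homogeneous k (a *: x).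
Proof. by move=> xk i ik; rewrite mxE xk ?mulr0. Qed.

Lemma homogeneousN k x : homogeneous k x -> homogeneous k (- x).
Proof. by move=> xk i ik; rewrite mxE xk ?oppr0. Qed.

Lemma homogeneous_gt k x : (s < k)%N -> homogeneous k x -> x = 0.
Proof. by move=> sk /homogeneous_filtered; exact: filtered_gt. Qed.

Lemma homogeneous_delta (i : index) :
  homogeneous (weight i) (delta_mx 0 i).
Proof.
by move=> k; rewrite mxE eqxx /=; case: (eqVneq k i) => [->|//]; rewrite eqxx.
Qed.

Lemma span_closed (P : V -> Prop) (X : seq V) :
  P 0 -> (forall a x y, P x -> P y -> P (a *: x + y)) ->
  {in X, forall x, P x} -> forall x, x \in <<X>>%VS -> P x.
Proof.
move=> P0 PD PX x; rewrite -(in_tupleE X) => /coord_span ->.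
apply: (big_rec P) => // i y _ Py; apply: PD => //; apply: PX.
by rewrite in_tupleE mem_nth.
Qed.

Lemma mem_layer (j : 'I_s.+1) (x : V) :
  x \in layer R m j <-> homogeneous j x.
Proof.
split.
  apply: span_closed.
  - exact: homogeneousz.
  - by move=> a u v uj vj; apply: homogeneousD => //; exact: homogeneousZ.
  - move=> u /mapP[k _ ->] i; rewrite /basis_vector mxE eqxx /=.
    by case: (eqVneq i) => [->|//]; rewrite /weight tagnat.Rank1K eqxx.
move=> xj; rewrite [x]row_sum_delta; apply: memv_suml => i _.
have [ij|ij] := eqVneq (weight i) j; last by rewrite (xj _ ij) scale0r mem0v.
have {ij} <- : tagnat.sig1 i = j by apply: val_inj.
apply/memvZ/memv_span/mapP; exists (tagnat.sig2 i); first by rewrite mem_enum.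
by rewrite /basis_vector tagnat.sig2K.
Qed.

Lemma mem_bracket_space (br : {bilinear V -> V -> V}) (U W : {vspace V}) u w :
  u \in U -> w \in W -> br u w \in bracket_space br U W.
Proof.
move=> /coord_vbasis uE /coord_vbasis wE; rewrite uE wE.
rewrite linear_sumlz; apply: memv_suml => i _.
rewrite linear_sumr; apply: memv_suml => j _.
rewrite linearZl_LR linearZr_LR; apply/memvZ/memvZ/memv_span.
by apply: allpairs_f; rewrite mem_nth // size_tuple.
Qed.

End Grading.

Section CarnotBracket.
Context (R : realType) (s : nat) (m : 'I_s.+1 -> nat) (G : carnot_group R m).
Local Notation V := (coords R m).
Local Notation index := 'I_(\sum_j m j).

Lemma bracket_is_bilinear : bilinear_for
  (GRing.Scale.Law.clone _ _ *:%R _) (GRing.Scale.Law.clone _ _ *:%R _)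
  (bracket G).
Proof. by split=> u a x y; [exact: bracket_linearl|exact: bracket_linearr]. Qed.

HB.instance Definition _ := bilinear_isBilinear.Build R V V V _ _ (bracket G)
  bracket_is_bilinear.

End CarnotBracket.

(** * Compatibility of the bracket and the group law with the grading *)

Section Carnot.
Context (R : realType) (s : nat) (m : 'I_s.+1 -> nat) (G : carnot_group R m).
Local Notation V := (coords R m).
Local Notation index := 'I_(\sum_j m j).

Lemma bracketDl x y z : bracket G (x + y) z = bracket G x z + bracket G y z.
Proof. exact: linearDl. Qed.

Lemma bracketDr x y z : bracket G z (x + y) = bracket G z x + bracket G z y.
Proof. exact: linearDr. Qed.

Lemma bracketZl a x z : bracket G (a *: x) z = a *: bracket G x z.
Proof. exact: linearZl_LR. Qed.

Lemma bracketZr a x z : bracket G z (a *: x) = a *: bracket G z x.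
Proof. exact: linearZr_LR. Qed.

Lemma bracketNl x z : bracket G (- x) z = - bracket G x z.
Proof. exact: linearNl. Qed.

Lemma bracketNr x z : bracket G z (- x) = - bracket G z x.
Proof. exact: linearNr. Qed.

Lemma bracketBl x y z : bracket G (x - y) z = bracket G x z - bracket G y z.
Proof. exact: linearBl. Qed.

Lemma bracketBr x y z : bracket G z (x - y) = bracket G z x - bracket G z y.
Proof. exact: linearBr. Qed.

Lemma bracket0l z : bracket G 0 z = 0.
Proof. exact: linear0l. Qed.

Lemma bracket0r z : bracket G z 0 = 0.
Proof. exact: linear0r. Qed.

Lemma bracketC x y : bracket G x y = - bracket G y x.
Proof.
apply/eqP; rewrite -addr_eq0; apply/eqP.
have := bracketxx G (x + y).
by rewrite bracketDl !bracketDr !bracketxx add0r addr0.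
Qed.

Lemma homogeneous_bracket0 b x y : homogeneous 0 x -> homogeneous b y ->
  homogeneous b.+1 (bracket G x y).
Proof.
move=> x0 yb; have [bs|sb] := leqP b s; last first.
  by rewrite (homogeneous_gt sb yb) bracket0r; exact: homogeneousz.
have xl : x \in layer R m ord0 by apply/mem_layer.
have yl : y \in layer R m (inord b) by apply/mem_layer; rewrite inordK.
have := mem_bracket_space (bracket G) xl yl.
move: bs; rewrite leq_eqVlt => /predU1P[bs|bs].
  have -> : inord b = ord_max :> 'I_s.+1 by apply: val_inj; rewrite /= inordK ?bs.
  by rewrite bracket_last memv0 => /eqP ->; exact: homogeneousz.
rewrite (@bracket_layer _ _ _ G _ (inord b.+1)) ?inordK //.
by move=> /mem_layer; rewrite inordK.
by rewrite ltnW.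
Qed.

(** Induction on a. The layer a + 1 is spanned by brackets [u, w] with u in the layer 0 and w in the
    layer a, and the Jacobi identity gives [[u, w], y] = [u, [w, y]] - [w, [u, y]]. The successor in
    the conclusion comes from counting layers from 0. *)
Lemma homogeneous_bracket a b x y : homogeneous a x -> homogeneous b y ->
  homogeneous (a + b).+1 (bracket G x y).
Proof.
elim: a b x y => [|a ih] b x y xa yb; first exact: homogeneous_bracket0.
have [as_|sa] := leqP a.+1 s; last first.
  by rewrite (homogeneous_gt sa xa) bracket0l; exact: homogeneousz.
have : x \in layer R m (inord a.+1) by apply/mem_layer; rewrite inordK.
rewrite -(@bracket_layer _ _ _ G (inord a) (inord a.+1)); last first.
  by rewrite !inordK // ltnW.
move: x {xa}; apply: span_closed.
- by rewrite bracket0l; exact: homogeneousz.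
- move=> c u v u_ v_; rewrite bracketDl bracketZl.
  by apply: homogeneousD => //; exact: homogeneousZ.
move=> _ /allpairsP[[u w] /= [/vbasis_mem/mem_layer u0 /vbasis_mem/mem_layer wa ->]].
rewrite inordK in wa; last by rewrite ltnW.
have -> : bracket G (bracket G u w) y =
    bracket G u (bracket G w y) - bracket G w (bracket G u y).
  have /eqP := bracket_jacobi G u w y.
  rewrite addrC addr_eq0 => /eqP E.
  by rewrite (bracketC (bracket G u w) y) E opprK (bracketC y u) bracketNr.
apply: homogeneousD.
  by rewrite addSn; apply: homogeneous_bracket0 => //; exact: ih.
apply/homogeneousN; rewrite addSn -addnS; apply: ih => //.
exact: homogeneous_bracket0.
Qed.

Lemma bracket_coord x y k : bracket G x y 0 k =
  \sum_i \sum_j x 0 i * y 0 j * bracket G (delta_mx 0 i) (delta_mx 0 j) 0 k.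
Proof.
rewrite {1}[x]row_sum_delta linear_sumlz summxE; apply: eq_bigr => i _.
rewrite {1}[y]row_sum_delta linear_sumr summxE; apply: eq_bigr => j _.
by rewrite /= bracketZl bracketZr !mxE mulrA.
Qed.

Lemma bracket_delta_eq0 (i j k : index) : weight k != (weight i + weight j).+1 ->
  bracket G (delta_mx 0 i) (delta_mx 0 j) 0 k = 0.
Proof. by apply: homogeneous_bracket; exact: homogeneous_delta. Qed.

(** The structure constant of i, j, k vanishes unless [weight k] is [(weight i + weight j).+1]. *)
Lemma filtered_bracket a b x y : filtered a x -> filtered b y ->
  filtered (a + b).+1 (bracket G x y).
Proof.
move=> xa yb k kab; rewrite bracket_coord big1 // => i _; rewrite big1 // => j _.
have [ia|ai] := ltnP (weight i) a; first by rewrite (xa _ ia) !mul0r.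
have [jb|bj] := ltnP (weight j) b; first by rewrite (yb _ jb) mulr0 mul0r.
rewrite bracket_delta_eq0 ?mulr0 //; lia.
Qed.

Definition dilation (t : R) (x : V) : V := \row_i (t ^+ (weight i).+1 * x 0 i).

Lemma dilation_is_linear t : linear (dilation t).
Proof. by move=> a x y; apply/rowP => i; rewrite !mxE; ring. Qed.

HB.instance Definition _ t :=
  GRing.isLinear.Build R V V _ (dilation t) (dilation_is_linear t).

Lemma dilation_bracket t x y :
  dilation t (bracket G x y) = bracket G (dilation t x) (dilation t y).
Proof.
apply/rowP => k; rewrite mxE !bracket_coord mulr_sumr; apply: eq_bigr => i _.
rewrite mulr_sumr; apply: eq_bigr => j _; rewrite !mxE.
have [->|kij] := eqVneq (weight k) (weight i + weight j).+1.
  by rewrite -addSn -addnS exprD; ring.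
by rewrite bracket_delta_eq0 ?mulr0.
Qed.

Lemma dilationM t u x : dilation t (dilation u x) = dilation (t * u) x.
Proof. by apply/rowP => i; rewrite !mxE exprMn mulrA. Qed.

Lemma dilation1 x : dilation 1 x = x.
Proof. by apply/rowP => i; rewrite !mxE expr1n mul1r. Qed.

(** Dilations are endomorphisms of the bracket and so commute with every term of the
    Baker-Campbell-Hausdorff sum. *)
Lemma dilation_law t x y :
  dilation t (law G x y) = law G (dilation t x) (dilation t y).
Proof.
rewrite !lawE /bch linear_sum; apply: eq_bigr => k _.
rewrite linear_sum; apply: eq_bigr => f _; rewrite linearZ_LR; congr (_ *: _).
rewrite !dynkin_wordE; elim: dynkin_letters => [|a [|b w] ih]; first exact: linear0.
  by case: a.
by rewrite /= dilation_bracket -[X in bracket G _ X]/(dilation t _) ih; case: a.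
Qed.

Lemma law_tail x y : law G x y = x + y + bch_tail (bracket G) s.+1 (leq 2) x y.
Proof. by rewrite lawE bch_split2. Qed.

Lemma bch_tail_closed (P : V -> Prop) n x y :
  P 0 -> (forall u v, P u -> P v -> P (u + v)) -> (forall a u, P u -> P (a *: u)) ->
  (forall w : seq bool, (n <= size w)%N ->
     P (nested_bracket (bracket G) (map (letter x y) w))) ->
  P (bch_tail (bracket G) s.+1 (leq n) x y).
Proof.
move=> P0 PD PZ Pw; apply: (big_ind P) => // k _; apply: (big_ind P) => // f.
by move=> /andP[_ nf]; apply/PZ/Pw.
Qed.

(** The deviation of the law from addition is a combination of nested brackets of at least two
    letters, whose innermost brackets are 0 or plus or minus [x, y]. *)
Lemma law_closed (P : V -> Prop) x y :
  P 0 -> (forall u v, P u -> P v -> P (u + v)) -> (forall a u, P u -> P (a *: u)) ->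
  P (bracket G x y) -> (forall u v, P v -> P (bracket G u v)) ->
  P (law G x y - x - y).
Proof.
move=> P0 PD PZ Pxy Pbr.
have -> : law G x y - x - y = bch_tail (bracket G) s.+1 (leq 2) x y.
  by rewrite law_tail -addrA -opprD addrAC subrr add0r.
apply: bch_tail_closed => // w w2.
apply: nested_bracket_closed; rewrite ?size_map //.
  move=> _ _ /mapP[a _ ->] /mapP[b _ ->].
  have Pz z : P (bracket G z z) by rewrite bracketxx.
  have Pyx : P (bracket G y x) by rewrite bracketC -scaleN1r; exact: PZ.
  by case: a b => [] [].
by move=> *; exact: Pbr.
Qed.

Lemma law_filtered i x y : filtered i (bracket G x y) ->
  filtered i (law G x y - x - y).
Proof.
move=> xy; apply: law_closed => //.
- exact: filteredz.
- by move=> *; exact: filteredD.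
- by move=> *; exact: filteredZ.
move=> u v vi; apply: (@filtered_leq _ _ _ _ (0 + i).+1); first by rewrite add0n.
by apply: filtered_bracket.
Qed.

Lemma law_filtered2 i x y : filtered i (bracket G x y) ->
  filtered i.+1 (law G x y - x - y - 2^-1 *: bracket G x y).
Proof.
move=> xyi; have -> : law G x y - x - y - 2^-1 *: bracket G x y =
    bch_tail (bracket G) s.+1 (leq 3) x y.
  rewrite law_tail bch_split3 //; first by apply/rowP => k; rewrite !mxE; ring.
  exact: bracketxx.
  exact: bracketC.
have brP u v k : filtered k v -> filtered k.+1 (bracket G u v).
  exact: (filtered_bracket (@filtered0 _ _ _ u)).
apply: bch_tail_closed.
- exact: filteredz.
- by move=> *; exact: filteredD.
- by move=> *; exact: filteredZ.
(* The outermost letter gains one layer; at least two letters remain in the inner bracket. *)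
move=> [//|a [//|b w]] w2; rewrite /=; apply: (brP).
rewrite -[X in filtered _ X]/
  (nested_bracket (bracket G) (map (letter x y) (b :: w))).
apply: nested_bracket_closed; last by rewrite size_map.
  move=> _ _ /mapP[c _ ->] /mapP[d _ ->].
  have Pz z : filtered i (bracket G z z) by rewrite bracketxx; exact: filteredz.
  have Pyx : filtered i (bracket G y x) by rewrite bracketC; exact: filteredN.
  by case: c d => [] [].
by move=> u z _ /(brP u); exact: filtered_leq.
Qed.

(** Induction by [a, z] - [a', z'] = [a - a', z] + [a', z - z'], where each bracket raises the
    filtration by one. The weaker conclusion also covers words of one letter and is what the
    induction uses. *)
Lemma nested_filtered_congr j (w w' : seq V) :
  size w = size w' -> (forall k, filtered j (w`_k - w'`_k)) ->
  filtered j (nested_bracket (bracket G) w - nested_bracket (bracket G) w') /\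
  ((1 < size w)%N ->
  filtered j.+1 (nested_bracket (bracket G) w - nested_bracket (bracket G) w')).
Proof.
elim: w w' => [|a w ih] [|a' w'] //= => [_ _|[sw] ww'].
  by rewrite subrr; split=> //; exact: filteredz.
have /= aa' := ww' 0%N.
case: w w' sw ih ww' => [|b w] [|b' w'] // sw ih ww'.
have {ih} [ih _] := ih (b' :: w') sw (fun k => ww' k.+1).
suff H : filtered j.+1 (bracket G a (nested_bracket (bracket G) (b :: w))
    - bracket G a' (nested_bracket (bracket G) (b' :: w'))).
  by split=> // ; exact: filtered_leq H.
set z := nested_bracket _ _ in ih *; set z' := nested_bracket _ (b' :: _) in ih *.
have -> : bracket G a z - bracket G a' z' =
    bracket G (a - a') z + bracket G a' (z - z').
  by rewrite bracketBl bracketBr; apply/rowP => k; rewrite !mxE; ring.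
apply: filteredD.
  by rewrite -[j]addn0; apply: filtered_bracket => //; exact: filtered0.
by rewrite -[j]add0n; apply: filtered_bracket => //; exact: filtered0.
Qed.

(* The nonlinear part of the layer j of a product depends on the layers < j. *)
Lemma law_filtered_congr j x y x' y' : filtered j (x - x') -> filtered j (y - y') ->
  filtered j.+1 ((law G x y - x - y) - (law G x' y' - x' - y')).
Proof.
move=> xx yy.
have -> : (law G x y - x - y) - (law G x' y' - x' - y') =
    bch_tail (bracket G) s.+1 (leq 2) x y - bch_tail (bracket G) s.+1 (leq 2) x' y'.
  by rewrite !law_tail; apply/rowP => k; rewrite !mxE; ring.
rewrite /bch_tail -sumrB; apply: filtered_sum => k _.
rewrite -sumrB; apply: filtered_sum => f /andP[_ f2].
rewrite -scalerBr; apply: filteredZ.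
apply: (nested_filtered_congr _ _).2; rewrite ?size_map // => i.
have [ilt|ige] := ltnP i (size (dynkin_letters f)); last first.
  by rewrite !nth_default ?size_map // subrr; exact: filteredz.
by rewrite !(nth_map false) //; case: nth.
Qed.

(** The products u = x * y and v = (-x) * (-y) have opposite linear parts and the same second order
    term [x, y] / 2, so u + v is [x, y] modulo the filtration j + 2. As v is -u modulo the
    filtration j + 1, [u, v] lies in the filtration j + 2, and u * v agrees with u + v modulo it. *)
Lemma commutator_filtered j x y : filtered j y ->
  filtered j.+2 (law G (law G x y) (law G (- x) (- y)) - bracket G x y).
Proof.
move=> yj; set c := bracket G x y.
have cj : filtered j.+1 c by exact: (filtered_bracket (@filtered0 _ _ _ x)).
have := law_filtered2 cj; set u := law G x y => e1.
have : bracket G (- x) (- y) = c by rewrite bracketNl bracketNr opprK.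
move=> E; have := @law_filtered2 j.+1 (- x) (- y); rewrite E => /(_ cj).
set v := law G (- x) (- y) => e2.
set d1 := (X in filtered _ X) in e1; set d2 := (X in filtered _ X) in e2.
have vE : v = - u + (c + (d1 + d2)).
  by rewrite /d1 /d2 -/c; apply/rowP => k; rewrite !mxE; field.
have uv : filtered j.+2 (bracket G u v).
  rewrite vE bracketDr bracketNr bracketxx oppr0 add0r.
  apply: (@filtered_bracket 0 j.+1) => //; apply: filteredD => //.
  by apply: (@filtered_leq _ _ _ _ j.+2) => //; exact: filteredD.
have -> : law G u v - c = (law G u v - u - v) + (d1 + d2).
  by rewrite vE; apply/rowP => k; rewrite !mxE; ring.
by apply: filteredD; [exact: law_filtered|exact: filteredD].
Qed.

Lemma law_parallel t h v : law G (t *: v) (h *: v) = (t + h) *: v.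
Proof.
have : law G (t *: v) (h *: v) - t *: v - h *: v = 0.
  apply: (law_closed (P := fun u => u = 0)) => //.
  - by move=> ? ? -> ->; rewrite addr0.
  - by move=> ? ? ->; rewrite scaler0.
  - by rewrite bracketZl bracketZr bracketxx !scaler0.
  - by move=> ? ? ->; rewrite bracket0r.
by rewrite -addrA -opprD => /eqP; rewrite subr_eq0 scalerDl => /eqP.
Qed.

End Carnot.

(** * Bounds and differentiability of the group law *)

Section Estimates.
Context (R : realType) (n : nat).
Implicit Types x y : 'rV[R]_n.

Lemma coord_le_norm x i : `|x 0 i| <= `|x|.
Proof.
rewrite [leRHS]/Num.norm /= mx_normrE.
by apply/bigmax_geP; right => /=; exists (0, i).
Qed.

Lemma norm_le_coord x r : 0 <= r -> (forall i, `|x 0 i| <= r) -> `|x| <= r.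
Proof.
move=> r0 xr; rewrite /Num.norm /= mx_normrE.
apply/bigmax_leP; split=> // -[i j] _ /=.
by rewrite (ord1 i).
Qed.

End Estimates.

Section CarnotEstimates.
Context (R : realType) (s : nat) (m : 'I_s.+1 -> nat) (G : carnot_group R m).
Local Notation V := (coords R m).
Local Notation index := 'I_(\sum_j m j).

Lemma bracket_delta x y : bracket G x y =
  \sum_i \sum_j (x 0 i * y 0 j) *: bracket G (delta_mx 0 i) (delta_mx 0 j).
Proof.
apply/rowP => k; rewrite bracket_coord summxE; apply: eq_bigr => i _.
by rewrite summxE; apply: eq_bigr => j _; rewrite [RHS]mxE.
Qed.

Lemma bracket_bound : exists2 K : R, 1 <= K &
  forall x y, `|bracket G x y| <= K * `|x| * `|y|.
Proof.
exists (1 + \sum_i \sum_j `|bracket G (delta_mx 0 i) (delta_mx 0 j)|).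
  by rewrite lerDl; apply: sumr_ge0 => i _; apply: sumr_ge0.
move=> x y; rewrite bracket_delta -mulrA mulrDl.
apply: (@le_trans _ _ (\sum_i \sum_j
  `|bracket G (delta_mx 0 i) (delta_mx 0 j)| * (`|x| * `|y|))).
  apply: (le_trans (ler_norm_sum _ _ _)); apply: ler_sum => i _.
  apply: (le_trans (ler_norm_sum _ _ _)); apply: ler_sum => j _.
  rewrite normrZ mulrC ler_wpM2l // normrM.
  by apply: ler_pM => //; exact: coord_le_norm.
rewrite [X in _ + X]mulr_suml -[leLHS]add0r lerD ?mulr_ge0 //.
by apply: ler_sum => i _; rewrite -mulr_suml.
Qed.

(** The second bound is linear in y as soon as y occurs in the word; it makes the nonlinear part of
    x * y small with y. *)
Lemma nested_bracket_bound (rho : R) : exists2 D : R, 1 <= D &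
  forall x y, `|x| <= rho -> `|y| <= rho -> forall w : seq bool, w != [::] ->
  let z := nested_bracket (bracket G) (map (letter x y) w) in
  `|z| <= D ^+ size w /\ (true \in w -> `|z| <= D ^+ size w * `|y|).
Proof.
have [K K1 Kbr] := bracket_bound.
pose r := Num.max 1 rho; have r1 : 1 <= r by rewrite le_max lexx.
have K0 : 0 <= K by exact: le_trans K1.
have r0 : 0 <= r by exact: le_trans r1.
have D1 : 1 <= K * r by rewrite -[1]mulr1 ler_pM.
have D0 : 0 <= K * r by exact: le_trans D1.
exists (K * r) => // x y xr yr.
have {}xr : `|x| <= r by rewrite le_max xr orbT.
have {}yr : `|y| <= r by rewrite le_max yr orbT.
have lr a : `|letter x y a| <= r by case: a.
have rD : r <= K * r by rewrite ler_peMl.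
elim=> [//|a [_|b w]] ih.
  rewrite /= expr1; split; first exact: le_trans rD.
  by rewrite inE => /eqP <-; rewrite /= ler_peMl.
move=> _; have [] := ih isT; set z := nested_bracket _ _ => zD zy.
rewrite [nested_bracket _ _]/(bracket G (letter x y a) z).
have -> : size [:: a, b & w] = (size (b :: w)).+1 by []; split.
  apply: (le_trans (Kbr _ _)); rewrite exprS; apply: ler_pM => //.
    by rewrite mulr_ge0.
  by rewrite ler_wpM2l.
rewrite inE => /predU1P[<-|bw].
  apply: (le_trans (Kbr _ _)).
  have -> : (K * r) ^+ (size (b :: w)).+1 * `|y| =
      (K * `|y|) * (r * (K * r) ^+ size (b :: w)) by rewrite exprS; ring.
  apply: ler_wpM2l; first by rewrite mulr_ge0.
  by apply: (le_trans zD); rewrite ler_peMl // exprn_ge0.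
apply: (le_trans (Kbr _ _)); rewrite exprS -[leRHS]mulrA; apply: ler_pM => //.
- by rewrite mulr_ge0.
- by rewrite ler_wpM2l.
- exact: zy.
Qed.

(** A word of at least two letters without y is a bracket of copies of x and vanishes; all other
    terms are bounded by a multiple of |y|. *)
Lemma law_bound (rho : R) : exists2 C : R, 0 <= C &
  forall x y, `|x| <= rho -> `|y| <= rho -> `|law G x y - x - y| <= C * `|y|.
Proof.
have [D D1 Dbr] := nested_bracket_bound rho.
have D0 : 0 <= D by exact: le_trans D1.
exists (\sum_(1 <= k < s.+2)
  \sum_(f : {ffun 'I_k -> 'I_s.+2 * 'I_s.+2}
     | [forall i, 0 < (f i).1 + (f i).2]%N && (2 <= size (dynkin_letters f))%N)
  `|dynkin_coef R f| * D ^+ size (dynkin_letters f)).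
  apply: sumr_ge0 => k _; apply: sumr_ge0 => f _.
  by rewrite mulr_ge0 // exprn_ge0.
move=> x y xr yr.
rewrite law_tail -addrA -opprD addrAC subrr add0r /bch_tail mulr_suml.
apply: (le_trans (ler_norm_sum _ _ _)); apply: ler_sum => k _.
rewrite mulr_suml.
apply: (le_trans (ler_norm_sum _ _ _)); apply: ler_sum => f /andP[_ f2].
rewrite normrZ -mulrA ler_wpM2l //.
have [wy|nwy] := boolP (true \in dynkin_letters f).
  by apply: (Dbr x y xr yr _ _).2 => //; case: dynkin_letters f2.
rewrite (nested_bracket_closed (P := fun u => u = 0)) ?size_map //.
- by rewrite normr0 mulr_ge0 // exprn_ge0.
- move=> _ _ /mapP[a aw ->] /mapP[b bw ->].
  by case: a b aw bw nwy => [] [] // => [-> //|-> //|_ -> //|]; rewrite bracketxx.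
- by move=> a z _ ->; rewrite bracket0r.
Qed.

Lemma law_bounded (rho : R) : exists2 C : R, 0 <= C &
  forall x y, `|x| <= rho -> `|y| <= rho -> `|law G x y| <= C.
Proof.
have [C C0 lawC] := law_bound rho.
exists (C * `|rho| + `|rho| + `|rho|); first by rewrite !addr_ge0 // mulr_ge0.
move=> x y xr yr.
have -> : law G x y = (law G x y - x - y) + x + y by rewrite addrAC subrK subrK.
have rr : rho <= `|rho| by exact: ler_norm.
apply: (le_trans (ler_normD _ _)); apply: lerD; last exact: le_trans rr.
apply: (le_trans (ler_normD _ _)); apply: lerD; last exact: le_trans rr.
apply: (le_trans (lawC _ _ xr yr)); apply: ler_wpM2l => //; exact: le_trans rr.
Qed.

Lemma differentiable_bracket (W : normedModType R) (f g : W -> V) (x : W) :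
  differentiable f x -> differentiable g x ->
  differentiable (fun y => bracket G (f y) (g y)) x.
Proof.
move=> df dg.
have -> : (fun y => bracket G (f y) (g y)) = \sum_i \sum_j (fun y =>
    (f y 0 i * g y 0 j) *: bracket G (delta_mx 0 i) (delta_mx 0 j)).
  apply/funext => y; rewrite fct_sumE bracket_delta; apply: eq_bigr => i _.
  by rewrite fct_sumE.
apply: differentiable_sum => i; apply: differentiable_sum => j.
apply: (differentiableZl (k := fun y => f y 0 i * g y 0 j)).
apply: (differentiableM (f := fun y => f y 0 i) (g := fun y => g y 0 j)).
  exact: (differentiable_comp df (differentiable_coord _ _ _)).
exact: (differentiable_comp dg (differentiable_coord _ _ _)).
Qed.

Lemma differentiable_nested_bracket q (w : seq bool) y :
  differentiable (fun y => nested_bracket (bracket G) (map (letter q y) w)) y.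
Proof.
have dl a : differentiable (fun y => letter q y a) y.
  have did : differentiable (id : V -> V) y by [].
  by case: a; [exact: did|exact: (differentiable_cst q)].
elim: w => [|a [_|b w ih]]; first exact: differentiable_cst.
  exact: dl.
exact: differentiable_bracket.
Qed.

Lemma differentiable_bigsum (W : normedModType R) (I : Type) (r : seq I)
    (P : pred I) (f : I -> W -> V) (x : W) :
  (forall i, P i -> differentiable (f i) x) ->
  differentiable (fun y => \sum_(i <- r | P i) f i y) x.
Proof.
move=> df; elim: r => [|i r ih].
  rewrite (_ : (fun _ => _) = cst 0); first exact: differentiable_cst.
  by apply/funext => y; rewrite big_nil.
have [Pi|nPi] := boolP (P i).
  rewrite (_ : (fun _ => _) = f i + (fun y => \sum_(i <- r | P i) f i y)).
    by apply: differentiableD => //; exact: df.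
  by apply/funext => y; rewrite big_cons Pi.
rewrite (_ : (fun _ => _) = (fun y => \sum_(i <- r | P i) f i y)) //.
by apply/funext => y; rewrite big_cons (negbTE nPi).
Qed.

Lemma differentiable_law q y : differentiable (law G q) y.
Proof.
have -> : law G q = (fun y => bch_tail (bracket G) s.+1 xpredT q y).
  by apply/funext => z; rewrite lawE bch_tailE.
apply: differentiable_bigsum => k _; apply: differentiable_bigsum => f _.
by apply: differentiableZ; exact: differentiable_nested_bracket.
Qed.

Lemma continuous_law q : continuous (law G q).
Proof. by move=> y; exact/differentiable_continuous/differentiable_law. Qed.

Lemma continuous_dilation t : continuous (@dilation R s m t).
Proof.
move=> x; apply: differentiable_continuous.
have -> : @dilation R s m t = \sum_i (fun x : V =>
    (t ^+ (weight i).+1 * x 0 i) *: delta_mx 0 i).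
  apply/funext => y; rewrite fct_sumE [LHS]row_sum_delta.
  by apply: eq_bigr => i _; rewrite mxE.
apply: differentiable_sum => i.
apply: (differentiableZl (k := fun x : V => t ^+ (weight i).+1 * x 0 i)).
apply: (differentiableM (f := cst (t ^+ (weight i).+1)) (g := fun x : V => x 0 i)).
  exact: differentiable_cst.
exact: differentiable_coord.
Qed.

End CarnotEstimates.

(** * Bounded elements as products of horizontal elements *)

Section Reachability.
Context (R : realType) (s : nat) (m : 'I_s.+1 -> nat) (G : carnot_group R m).
Local Notation V := (coords R m).

(** The index n counts the horizontal factors, each of norm at most C. The tree shape lets products
    be multiplied without reassociation. *)
Inductive horizontal_product (C : R) : nat -> V -> Prop :=
| HorizontalFactor v : homogeneous 0 v -> `|v| <= C -> horizontal_product C 1 v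
| HorizontalLaw a b x y : horizontal_product C a x -> horizontal_product C b y ->
    horizontal_product C (a + b) (law G x y).

Lemma horizontal_product_le C C' n x : C <= C' ->
  horizontal_product C n x -> horizontal_product C' n x.
Proof.
move=> CC'; elim => [v v0 vC|a b u v _ xa _ yb].
  by apply: HorizontalFactor => //; exact: le_trans CC'.
exact: HorizontalLaw.
Qed.

Lemma lawK x y : law G (- x) (law G x y) = y.
Proof. by rewrite lawA lawNx law0x. Qed.

Lemma lawNK x y : law G x (law G (- x) y) = y.
Proof. by rewrite lawA lawxN law0x. Qed.

Lemma oppr_law x y : - law G x y = law G (- y) (- x).
Proof.
have E : law G (law G x y) (law G (- y) (- x)) = 0.
  by rewrite -lawA [law G y _]lawA lawxN law0x lawxN.
by rewrite -[RHS](lawK (law G x y)) E lawx0.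
Qed.

Lemma horizontal_productN C n x :
  horizontal_product C n x -> horizontal_product C n (- x).
Proof.
elim => [v v0 vC|a b u v _ xa _ yb].
  by apply: HorizontalFactor; [exact: homogeneousN|rewrite normrN].
by rewrite oppr_law addnC; exact: HorizontalLaw.
Qed.

Lemma horizontal_product_dilation t C n x : 0 <= t ->
  horizontal_product C n x -> horizontal_product (t * C) n (dilation t x).
Proof.
move=> t0; elim => [v v0 vC|a b u v _ xa _ yb].
  have -> : dilation t v = t *: v.
    apply/rowP => i; rewrite !mxE.
    have [->|i0] := eqVneq (weight i) 0%N; first by rewrite expr1.
    by rewrite (v0 _ i0) !mulr0.
  apply: HorizontalFactor; first exact: homogeneousZ.
  by rewrite normrZ ger0_norm // ler_wpM2l.
by rewrite dilation_law; exact: HorizontalLaw.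
Qed.

(** C and n are uniform over A. The norm bound is carried along because [law_bounded] requires
    bounded factors. *)
Definition reachable (A : set V) : Prop := exists C n, forall z, A z ->
  horizontal_product C n z /\ `|z| <= C.

Lemma reachable_sub (A B : set V) : A `<=` B -> reachable B -> reachable A.
Proof. by move=> AB [C [n CnB]]; exists C, n => z /AB; exact: CnB. Qed.

Lemma reachable_law (A B : set V) : reachable A -> reachable B ->
  reachable [set law G x y | x in A & y in B].
Proof.
move=> [C [n CnA]] [D [k DkB]].
have [E E0 lawE_] := law_bounded G (Num.max C D).
exists (Num.max E (Num.max C D)), (n + k)%N => _ [x /CnA[xn xC] [y /DkB[yk yD] <-]].
split; last by rewrite le_max lawE_ // le_max ?xC ?yD ?orbT.
apply: HorizontalLaw.
  by apply: horizontal_product_le xn; rewrite !le_max lexx !orbT.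
by apply: horizontal_product_le yk; rewrite !le_max lexx !orbT.
Qed.

Lemma reachableN (A : set V) : reachable A -> reachable [set - x | x in A].
Proof.
move=> [C [n CnA]]; exists C, n => _ [x /CnA[xn xC] <-].
by split; [exact: horizontal_productN|rewrite normrN].
Qed.

Lemma reachable_horizontal rho : reachable [set v | homogeneous 0 v /\ `|v| <= rho].
Proof. by exists rho, 1%N => v [v0 vr]; split=> //; exact: HorizontalFactor. Qed.

(** The layer j is reached only up to higher layers; [reachable_filtered] corrects the error layer
    by layer. *)
Definition reachable_layer (j : nat) : Prop := forall rho, exists A : set V,
  reachable A /\ forall w, homogeneous j w -> `|w| <= rho ->
    exists2 g, A g & filtered j.+1 (g - w).

Lemma reachable_layer0 : reachable_layer 0.
Proof.
move=> rho; exists [set v | homogeneous 0 v /\ `|v| <= rho].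
split; first exact: reachable_horizontal.
by move=> w w0 wr; exists w => //; rewrite subrr; exact: filteredz.
Qed.

(* c_k [u_k, w_k] is replaced with the group commutator of c_k u_k and of an
   element which agrees with w_k up to higher layers.                        *)
Lemma reachable_brackets j (X : seq (V * V)) C : reachable_layer j ->
  {in X, forall p, homogeneous 0 p.1 /\ homogeneous j p.2} ->
  exists A : set V, reachable A /\ forall c : nat -> R,
    (forall k, (k < size X)%N -> `|c k| <= C) ->
    exists2 h, A h & filtered j.+2
      (h - \sum_(k < size X) c k *: bracket G (X`_k).1 (X`_k).2).
Proof.
move=> rj; elim: X => [_|[u w] X ih X0j].
  exists [set v | homogeneous 0 v /\ `|v| <= 0]; split.
    exact: reachable_horizontal.
  move=> c _; exists 0; first by split; [exact: homogeneousz|rewrite normr0].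
  by rewrite big_ord0 subrr; exact: filteredz.
have [|A [rA AX]] := ih; first by move=> p pX; apply: X0j; rewrite inE pX orbT.
have [|/= u0 wj] := X0j (u, w); first by rewrite inE eqxx.
have [B [rB Bw]] := rj `|w|; have [g Bg gw] := Bw w wj (lexx _).
(* The coefficient c_0 is absorbed into the horizontal factor u, so that g is chosen for w alone,
   before c is known. *)
pose U := [set v : V | homogeneous 0 v /\ `|v| <= C * `|u|].
have rU : reachable U by exact: reachable_horizontal.
exists [set law G x y | x in
  [set law G x y | x in [set law G x y | x in U & y in B]
    & y in [set law G x y | x in [set - x | x in U] & y in [set - x | x in B]]]
  & y in A]; split.
  apply: reachable_law => //; apply: reachable_law.
    exact: reachable_law.
  by apply: reachable_law; exact: reachableN.
move=> c cC; have [|h Ah hX] := AX (fun k => c k.+1).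
  by move=> k kX; apply: cC.
have Ucu : U (c 0%N *: u).
  split; first exact: homogeneousZ.
  by rewrite normrZ ler_wpM2r // cC.
set q := law G (law G (c 0%N *: u) g) (law G (- (c 0%N *: u)) (- g)).
exists (law G q h).
  exists q; last by exists h.
  exists (law G (c 0%N *: u) g).
    by exists (c 0%N *: u) => //; exists g.
  exists (law G (- (c 0%N *: u)) (- g)) => //.
  by exists (- (c 0%N *: u)); [exists (c 0%N *: u)|exists (- g) => //; exists g].
have wj' := homogeneous_filtered wj.
have gj : filtered j g.
  by rewrite -[g](subrK w); apply: filteredD => //; exact: filtered_leq gw.
have brw a v : homogeneous 0 a -> filtered j v -> filtered j.+1 (bracket G a v).
  by move=> /homogeneous_filtered a0 vj; exact: (filtered_bracket G a0 vj).
have q1 : filtered j.+2 (q - c 0%N *: bracket G u w).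
  have -> : q - c 0%N *: bracket G u w =
      (q - bracket G (c 0%N *: u) g) + bracket G (c 0%N *: u) (g - w).
    by rewrite bracketBr !bracketZl addrA subrK.
  apply: filteredD; first exact: commutator_filtered.
  by apply: (@filtered_bracket _ _ _ G 0 j.+1).
have qj : filtered j.+1 q.
  rewrite -[q](subrK (c 0%N *: bracket G u w)).
  apply: filteredD; first exact: filtered_leq q1.
  by apply: filteredZ; exact: brw.
have hj : filtered j.+1 h.
  rewrite -[h](subrK (\sum_(k < size X) c k.+1 *: bracket G (X`_k).1 (X`_k).2)).
  apply: filteredD; first exact: filtered_leq hX.
  apply: filtered_sum => k _; apply: filteredZ.
  have [|k0 kj] := X0j X`_k; first by rewrite inE mem_nth ?orbT.
  by apply: brw => //; exact: homogeneous_filtered.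
rewrite (big_ord_recl (size X)) /=.
set S : V := (X in filtered _ (h - X)) in hX.
rewrite -[X in _ *: _ + X]/S.
rewrite (_ : _ - _ = (law G q h - q - h) + (q - c 0%N *: bracket G u w)
  + (h - S)); last first.
  by apply/rowP => k; rewrite !mxE; ring.
(* The bracket [q, h] lies in the filtration 2j + 3 >= j + 2, so multiplying q and h adds them up to
   this filtration. *)
apply: filteredD => //; apply: filteredD => //; apply: law_filtered.
by apply: (filtered_leq _ (filtered_bracket G qj hj)); lia.
Qed.

Lemma linear_functional_bound (f : {linear V -> R^o}) :
  exists2 C, 0 <= C & forall x, `|f x| <= C * `|x|.
Proof.
exists (\sum_i `|f (delta_mx 0 i) : R|); first exact: sumr_ge0.
move=> x; rewrite {1}[x]row_sum_delta linear_sum mulr_suml.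
apply: (le_trans (ler_norm_sum _ _ _)); apply: ler_sum => i _.
by rewrite linearZ /= normrM mulrC ler_wpM2l // coord_le_norm.
Qed.

(** By the stratification, brackets of basis vectors of the layers 0 and j span the layer j + 1. The
    coefficients [coord] of w in this spanning family are linear in w, hence bounded by a multiple
    of |w|. *)
Lemma reachable_layerS j : reachable_layer j -> reachable_layer j.+1.
Proof.
move=> rj rho; have [js|sj] := leqP j.+1 s; last first.
  exists [set v | homogeneous 0 v /\ `|v| <= 0]; split.
    exact: reachable_horizontal.
  move=> w wj _; exists 0; first by split; [exact: homogeneousz|rewrite normr0].
  by rewrite (homogeneous_gt sj wj) subrr; exact: filteredz.
have jE : (inord j : 'I_s.+1) = j :> nat by rewrite inordK // ltnW.
pose X := [seq (u, w) | u <- vbasis (layer R m ord0),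
  w <- vbasis (layer R m (inord j))].
have XE : [seq bracket G u w | u <- vbasis (layer R m ord0),
    w <- vbasis (layer R m (inord j))] = map (fun p => bracket G p.1 p.2) X.
  by rewrite map_allpairs.
have X0j : {in X, forall p, homogeneous 0 p.1 /\ homogeneous j p.2}.
  move=> _ /allpairsP[[u w] /= [/vbasis_mem/mem_layer u0 /vbasis_mem/mem_layer wj ->]].
  by rewrite jE in wj.
pose Y := map (fun p => bracket G p.1 p.2) X.
have coordC k : exists C, forall x, `|coord (in_tuple Y) k x| <= C * `|x|.
  by have [C _ CY] := linear_functional_bound (coord (in_tuple Y) k); exists C.
have [C CY] := choice coordC.
have [A [rA AX]] := reachable_brackets (\sum_k `|C k| * `|rho|) rj X0j.
exists A; split=> // w wj wr.
have wY : w \in <<in_tuple Y>>%VS.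
  rewrite /= /Y -XE -[<<_>>%VS]/(bracket_space (bracket G) _ _).
  rewrite (@bracket_layer _ _ _ G (inord j) (inord j.+1)).
    by apply/mem_layer; rewrite inordK.
  by rewrite jE inordK.
have szY : size Y = size X by rewrite size_map.
(* Only the first [size Y] coefficients are used; the others are set to 0. *)
have [|h Ah hw] := AX (fun k =>
  if insub k is Some i then coord (in_tuple Y) i w else 0).
  move=> k kX; rewrite -szY in kX; rewrite insubT /=.
  apply: (le_trans (CY _ _)).
  rewrite (bigD1 (Ordinal kX)) //= -[leLHS]addr0; apply: lerD.
    apply: (@le_trans _ _ (`|C (Ordinal kX)| * `|w|)).
      by rewrite ler_wpM2r // ler_norm.
    by rewrite ler_wpM2l // (le_trans wr) // ler_norm.
  by apply: sumr_ge0 => i _; rewrite mulr_ge0.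
exists h => //; rewrite [in X in filtered _ X](coord_span wY).
move: hw; congr (filtered _ (_ - _)).
rewrite -(big_mkord xpredT (fun k => (if insub k is Some i
  then coord (in_tuple Y) i w else 0) *: bracket G (X`_k).1 (X`_k).2)) -szY big_mkord.
apply: eq_bigr => k _; rewrite valK; congr (_ *: _).
by rewrite /= (nth_map 0) // -szY.
Qed.

Definition homogeneous_part (j : nat) (x : V) : V :=
  \row_i (if weight i == j then x 0 i else 0).

(** Descending induction on j. Some g in a reachable set agrees with z up to the filtration j + 1;
    then g^-1 * z lies in that filtration, is bounded, and is reached by induction. *)
Lemma reachable_filtered d j rho : (j + d)%N = s.+1 ->
  reachable [set z | filtered j z /\ `|z| <= rho].
Proof.
elim: d j rho => [|d ih] j rho jd.
  apply: reachable_sub (reachable_horizontal 0) => z [zj _].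
  rewrite (filtered_gt _ zj) /=; last by lia.
  by split; [exact: homogeneousz|rewrite normr0].
have rj : reachable_layer j.
  by elim: j {ih jd} => [|j /reachable_layerS//]; exact: reachable_layer0.
have [A [rA Aw]] := rj rho.
have [C [n CnA]] := rA.
have [D D0 lawD] := law_bounded G (Num.max C rho).
have rB := ih j.+1 D ltac:(lia).
apply: reachable_sub (reachable_law rA rB) => z [zj zr].
have wj : homogeneous j (homogeneous_part j z).
  by move=> i /negbTE ij; rewrite mxE ij.
have zw : filtered j.+1 (z - homogeneous_part j z).
  move=> i ij; rewrite !mxE; case: eqVneq => [_|ji]; first exact: subrr.
  by rewrite zj ?subrr // ltn_neqAle ji -ltnS.
have wr : `|homogeneous_part j z| <= rho.
  apply: norm_le_coord => [|i]; first exact: le_trans zr.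
  rewrite mxE; case: eqVneq => _; first exact: le_trans (coord_le_norm _ _) _.
  by rewrite normr0 (le_trans _ zr).
have [g Ag gw] := Aw _ wj wr.
have gj : filtered j g.
  rewrite -[g](subrK (homogeneous_part j z)); apply: filteredD.
    exact: filtered_leq gw.
  exact: homogeneous_filtered.
exists g => //; exists (law G (- g) z); last exact: lawNK.
split; last first.
  by apply: lawD; rewrite ?normrN le_max ?zr ?orbT // (CnA _ Ag).2.
have -> : law G (- g) z = (law G (- g) z - - g - z)
    + ((z - homogeneous_part j z) - (g - homogeneous_part j z)).
  by apply/rowP => i; rewrite !mxE; ring.
apply: filteredD; last exact: filteredB.
apply: law_filtered; apply: (@filtered_leq _ _ _ _ (j + j).+1); first lia.
by apply: filtered_bracket => //; exact: filteredN.
Qed.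

Lemma bounded_reachable rho : reachable [set z | `|z| <= rho].
Proof.
by apply: reachable_sub (@reachable_filtered s.+1 0 rho _).
Qed.

End Reachability.

(** * Length of piecewise horizontal curves *)

(** On [0, N] the integrand is dominated by a measurable function equal to c outside Z and to +oo on
    Z, and a countable set is null. *)
Lemma le_integral_countable (R : realType) (N c : R) (f : R -> R) (Z : set R) :
    0 <= N -> 0 <= c -> countable Z -> (forall t, 0 <= f t) ->
    (forall t, t \in `[0, N] -> ~ Z t -> f t <= c) ->
  (\int[@lebesgue_measure R]_(t in `[0%R, N]) (f t)%:E <= (c * N)%:E)%E.
Proof.
move=> N0 c0 Zc f0 fc.
have mZ : measurable Z by apply: countable_measurable => //.
pose g t : \bar R := if t \in Z then +oo%E else c%:E.
have g0 t : (0 <= g t)%E by rewrite /g; case: ifP; rewrite ?lee_fin ?leey.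
have mg : measurable_fun [set: R] g.
  apply: measurable_fun_ifT => //; apply: (measurable_fun_bool true).
  rewrite setTI (_ : _ @^-1` _ = Z) //; apply/seteqP; split=> t /=.
    by move=> /set_mem.
  by move=> Zt; rewrite mem_set.
apply: (@le_trans _ _ (\int[@lebesgue_measure R]_(t in `[0%R, N]) g t)%E).
  rewrite integral_mkcond [leRHS]integral_mkcond !ge0_integralTE; last 2 first.
  - by move=> t; apply: erestrict_ge0.
  - by move=> t; apply: erestrict_ge0 => x _; rewrite lee_fin.
  (* As suprema over simple functions, these integrals are monotone even though
     f may not be measurable. *)
  apply: ereal_sup_le => _ [h hf <-]; exists h => // t.
  apply: (le_trans (hf t)); rewrite /patch; case: ifP => // tN.
  rewrite /g; case: ifPn => [_|/negP tZ]; first by rewrite leey.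
  rewrite lee_fin fc //; first by rewrite in_setE in tN.
  by move=> Zt; apply: tZ; rewrite in_setE.
rewrite (@ae_eq_integral _ _ _ _ _ (cst c%:E)) //=.
- rewrite integral_cst //= lebesgue_measure_itv /= lte_fin.
  by case: ltP => _; rewrite ?mule0 ?lee_fin ?mulr_ge0 // subr0.
- exact: measurable_funTS.
- exists Z; split=> //; first exact: countable_lebesgue_measure0.
  move=> t /=; apply: contra_notP => Zt _; rewrite /g ifF //.
  by apply/negP; rewrite in_setE.
Qed.

Section Curves.
Context (R : realType) (s : nat) (m : 'I_s.+1 -> nat) (G : carnot_group R m).
Local Notation V := (coords R m).

(** Brackets have no component in the layer 0, where the law is thus addition. *)
Lemma law_coord0 p y i : weight i = 0%N -> law G p y 0 i = p 0 i + y 0 i.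
Proof.
move=> i0; have F1 : filtered 1 (bracket G p y).
  exact: (@filtered_bracket _ _ _ G 0 0).
have := law_filtered F1 (_ : weight i < 1)%N; rewrite i0 => /(_ isT).
by rewrite !mxE => /eqP; rewrite -addrA -opprD subr_eq0 => /eqP.
Qed.

Lemma left_fieldE v p : left_field G v p = 'd (law G p) 0 v.
Proof. by rewrite /left_field deriveE //; exact: differentiable_law. Qed.

Lemma left_field_coord0 v p i : weight i = 0%N -> left_field G v p 0 i = v 0 i.
Proof.
move=> i0; rewrite /left_field derive_mx; last first.
  exact/diff_derivable/differentiable_law.
rewrite mxE (_ : (fun t => law G p t 0 i) = cst (p 0 i) + (fun t => t 0 i)).
  have did := diff_derivable (v := v) (differentiable_coord (0 : V) 0 i).
  rewrite (deriveD (derivable_cst _ _ _) did).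
  rewrite [X in X + _](_ : _ = 0); last exact: derive_cst.
  rewrite add0r.
  have := derive_id (0 : V) v; rewrite derive_mx.
    by move=> /(congr1 (fun x : V => x 0 i)); rewrite mxE.
  exact: derivable_id.
by apply/funext => t; rewrite law_coord0.
Qed.

Lemma homogeneous0_sum v : homogeneous 0 v ->
  v = \sum_(k < m ord0) v 0 (tagnat.Rank ord0 k) *: basis_vector R k.
Proof.
move=> v0; apply/rowP => i; rewrite summxE.
have [i0|i0] := eqVneq (weight i) 0%N; last first.
  rewrite v0 // big1 // => k _; rewrite /basis_vector !mxE eqxx /=.
  case: eqVneq => [iE|_]; last by rewrite mulr0.
  by move: i0; rewrite iE /weight tagnat.Rank1K.
have [k ->] : exists k, i = tagnat.Rank ord0 k.
  have {}i0 : tagnat.sig1 i = ord0 by apply: val_inj.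
  exists (cast_ord (congr1 m i0) (tagnat.sig2 i)); apply/val_inj/eqP.
  rewrite -{1}(tagnat.sig2K i) /= tagnat.eq_Rank.
  by apply/andP; split; first exact/eqP.
rewrite (bigD1 k) //= /basis_vector !mxE !eqxx mulr1 [X in _ + X]big1 ?addr0 //.
move=> l lk; rewrite !mxE eqxx /= -val_eqE tagnat.eq_Rank eqxx /= val_eqE eq_sym.
by rewrite (negbTE lk) mulr0.
Qed.

Lemma nth_horizontal_frame p (k : 'I_(m ord0)) :
  (horizontal_frame G p)`_k = left_field G (basis_vector R k) p.
Proof. by rewrite -(tnth_nth 0 (horizontal_frame G p)) tnth_mktuple. Qed.

Lemma left_field_sum v p : homogeneous 0 v -> left_field G v p =
  \sum_(k < m ord0) v 0 (tagnat.Rank ord0 k) *: (horizontal_frame G p)`_k.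
Proof.
move=> v0; rewrite left_fieldE {1}(homogeneous0_sum v0) linear_sum.
apply: eq_bigr => k _; rewrite linearZ nth_horizontal_frame left_fieldE //.
Qed.

(** By [left_field_coord0], the coordinates in the layer 0 of a combination of the frame are its
    coefficients. Freeness lets [coord] in [horizontal_norm] read off these coefficients. *)
Lemma horizontal_frame_free p : free (horizontal_frame G p).
Proof.
apply/freeP => c c0 k; pose v : V := \sum_(l < m ord0) c l *: basis_vector R l.
have vE l : v 0 (tagnat.Rank ord0 l) = c l.
  rewrite /v summxE (bigD1 l) //= /basis_vector !mxE !eqxx mulr1.
  rewrite [X in _ + X]big1 ?addr0 // => l' ll'; rewrite !mxE eqxx /=.
  by rewrite -val_eqE tagnat.eq_Rank eqxx /= val_eqE eq_sym (negbTE ll') mulr0.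
have v0 : homogeneous 0 v.
  move=> i i0; rewrite /v summxE big1 // => l _; rewrite /basis_vector !mxE eqxx /=.
  case: eqVneq => [iE|_]; last by rewrite mulr0.
  by move: i0; rewrite iE /weight tagnat.Rank1K.
rewrite -vE -(left_field_coord0 _ p); last by rewrite /weight tagnat.Rank1K.
rewrite left_field_sum // (eq_bigr _ (fun l _ => congr1 ( *:%R^~ _) (vE l))) c0.
by rewrite mxE.
Qed.

Lemma horizontal_norm_left_field v p C : homogeneous 0 v -> `|v| <= C ->
  horizontal_norm G p (left_field G v p) <= Num.sqrt (m ord0)%:R * C.
Proof.
move=> v0 vC; rewrite /horizontal_norm left_field_sum //.
have C0 : 0 <= C by exact: le_trans vC.
rewrite -[X in _ * X](ger0_norm C0) -sqrtr_sqr -sqrtrM ?ler0n //.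
apply: ler_wsqrtr; rewrite mulr_natl.
rewrite -[in leRHS](card_ord (m ord0)) -sumr_const; apply: ler_sum => k _.
rewrite coord_sum_free ?horizontal_frame_free // -[leLHS]real_normK ?num_real //.
by rewrite ler_pXn2r ?nnegrE // (le_trans (coord_le_norm _ _)).
Qed.

(* Non-integral times suffice, since each factor of a product is run through in
   unit time.                                                                *)
Definition piecewise_horizontal (C : R) (n : nat) (p q : V) (c : R -> V) : Prop :=
  [/\ c 0 = p, c n%:R = q,
    exists2 K, 0 <= K & forall t u, 0 <= t -> t <= u -> u <= n%:R ->
      `|c u - c t| <= K * (u - t)
  & forall t, 0 < t -> t < n%:R -> ~ range (fun k : nat => k%:R : R) t ->
      exists v, [/\ homogeneous 0 v, `|v| <= C, derivable c t 1 &
        'D_1 c t = left_field G v (c t)]].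

Lemma law_line p v t u : law G (law G p (t *: v)) ((u - t) *: v) = law G p (u *: v).
Proof. by rewrite -lawA law_parallel addrC subrK. Qed.

(** The curve t |-> p * (t v) is an integral curve of the left-invariant field of v. It is Lipschitz
    by [law_bound], since it passes from time t to time u by right multiplication with (u - t) v. *)
Lemma piecewise_horizontal1 C p v : homogeneous 0 v -> `|v| <= C ->
  piecewise_horizontal C 1 p (law G p v) (fun t => law G p (t *: v)).
Proof.
move=> v0 vC; split.
- by rewrite scale0r lawx0.
- by rewrite scale1r.
- have [D D0 lawD] := law_bounded G (Num.max `|p| `|v|).
  have [E E0 lawE_] := law_bound G (Num.max D `|v|).
  exists ((E + 1) * `|v|); first by rewrite mulr_ge0 // addr_ge0.
  move=> t u t0 tu u1.
  have t1 : `|t *: v| <= `|v|.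
    by rewrite normrZ ler_piMl // ger0_norm // (le_trans tu).
  have ut1 : `|(u - t) *: v| <= `|v|.
    rewrite normrZ ler_piMl // ger0_norm ?subr_ge0 //.
    by rewrite lerBlDr (le_trans u1) // lerDl.
  rewrite -(law_line p v t u).
  set x := law G p (t *: v); set y := (u - t) *: v.
  have xD : `|x| <= D by rewrite lawD // le_max ?lexx ?t1 ?orbT.
  rewrite (_ : _ - x = (law G x y - x - y) + y); last by rewrite subrK.
  apply: (le_trans (ler_normD _ _)).
  apply: (@le_trans _ _ (E * `|y| + `|y|)).
    by rewrite lerD2r lawE_ // le_max ?xD ?ut1 ?orbT.
  rewrite -[X in _ + X]mul1r -mulrDl /y normrZ ger0_norm ?subr_ge0 //.
  by rewrite [leRHS]mulrAC mulrA.
- move=> t t0 t1 _; exists v.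
  (* As c(t + h) = c(t) * (h v), the difference quotients of the curve at t are those of y |-> c(t)
     * y at 0 along v. *)
  have dq : (fun h : R => h^-1 *:
        (((fun t => law G p (t *: v)) \o shift t) (h *: (1 : R))
        - law G p (t *: v))) =
      (fun h : R => h^-1 *: ((law G (law G p (t *: v)) \o shift 0) (h *: v)
        - law G (law G p (t *: v)) 0)).
    apply/funext => h /=; rewrite addr0 lawx0; congr (_ *: (_ - _)).
    by rewrite [h *: 1]mulr1 -(law_line p v t) addrK.
  split; [exact: v0|exact: vC| |by rewrite /left_field /derive dq].
  rewrite /derivable dq; apply/diff_derivable/differentiable_law.
Qed.

Lemma piecewise_horizontalD C a b p q r c d : piecewise_horizontal C a p q c ->
  piecewise_horizontal C b q r d ->
  piecewise_horizontal C (a + b) p r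
    (fun t => if t <= a%:R then c t else d (t - a%:R)).
Proof.
move=> [c0 ca [K K0 cK] dc] [d0 db [L L0 dL] dd]; split.
- by rewrite ler0n.
(* If b = 0, the end time still belongs to the first piece, but then r = d 0 = q. *)
- rewrite natrD; case: ifPn => [|_]; last by rewrite addrC addKr.
  by rewrite gerDl lern0 => /eqP b0; rewrite b0 addr0 ca -db b0 -d0.
- exists (Num.max K L); first by rewrite le_max K0.
  have KM : K <= Num.max K L by rewrite le_max lexx.
  have LM : L <= Num.max K L by rewrite le_max lexx orbT.
  move=> t u t0 tu; rewrite natrD => uab.
  have [ua|au] := leP u a%:R.
    rewrite (le_trans tu ua); apply: (le_trans (cK _ _ t0 tu ua)).
    by rewrite ler_wpM2r // subr_ge0.
  have [ta|at_] := leP t a%:R; last first.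
    have := dL (t - a%:R) (u - a%:R); rewrite subr_ge0 (ltW at_) lerD2r lerBlDl.
    move=> /(_ isT tu uab) /le_trans; apply.
    by rewrite opprB addrA subrK ler_wpM2r // subr_ge0.
  rewrite -[d _](subrK q) -addrA -ca {1}ca -d0.
  apply: (le_trans (ler_normD _ _)).
  have -> : u - t = (u - a%:R) + (a%:R - t) by rewrite addrA subrK.
  rewrite mulrDr; apply: lerD.
    have := dL 0 (u - a%:R) (lexx _); rewrite subr_ge0 (ltW au) lerBlDl subr0.
    move=> /(_ isT uab) /le_trans; apply; rewrite ler_wpM2r // subr_ge0 ltW //.
  apply: (le_trans (cK _ _ t0 ta (lexx _))).
  by rewrite ler_wpM2r // subr_ge0.
- move=> t t0; rewrite natrD => tab tZ.
  (* The junction time a is a natural number, hence excluded; elsewhere the concatenation coincides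
     near t with one of the pieces. *)
  have [ta|at_|ta] := ltgtP t a%:R; last by exfalso; apply: tZ; exists a.
    have [v [v0 vC dct ct]] := dc t t0 ta tZ; exists v.
    have near_c : \near t, c t = (if t <= a%:R then c t else d (t - a%:R)).
      by near=> u; rewrite ifT //; near: u; exact: lt_le_nbhsl.
    split; [exact: v0|exact: vC|exact: near_eq_derivable near_c dct|].
    rewrite -(near_eq_derive _ near_c); exact: ct.
  have [|||v [v0 vC ddt dt]] := dd (t - a%:R).
  - by rewrite subr_gt0.
  - by rewrite ltrBlDl.
  - move=> [k _ kE]; apply: tZ; exists (a + k)%N => //.
    by rewrite natrD kE addrC subrK.
  exists v; pose e u := d (u - a%:R).
  have near_d : \near t, e t = (if t <= a%:R then c t else d (t - a%:R)).
    near=> u; rewrite ifF //; apply/negbTE; rewrite -ltNge.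
    by near: u; exact: lt_nbhsr.
  have dq : (fun h : R => h^-1 *: ((e \o shift t) (h *: (1 : R)) - e t)) =
     (fun h : R => h^-1 *: ((d \o shift (t - a%:R)) (h *: (1 : R)) - d (t - a%:R))).
    by apply/funext => h /=; rewrite /e addrA.
  have det : derivable e t 1 by rewrite /derivable dq.
  split; [exact: v0|exact: vC|exact: near_eq_derivable near_d det|].
  rewrite -(near_eq_derive _ near_d) /derive dq; exact: dt.
Unshelve. all: by end_near. Qed.

Lemma horizontal_product_curve C n z p : horizontal_product G C n z ->
  exists c, piecewise_horizontal C n p (law G p z) c.
Proof.
move=> zn; elim: zn p => [v v0 vC|a b x y _ xa _ yb] p.
  by exists (fun t => law G p (t *: v)); exact: piecewise_horizontal1.
have [c pc] := xa p; have [d pd] := yb (law G p x).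
by exists (fun t => if t <= a%:R then c t else d (t - a%:R)); rewrite lawA;
  exact: piecewise_horizontalD pd.
Qed.

Lemma countable_naturals : countable (range (fun k : nat => k%:R : R)).
Proof. exact: card_image_le. Qed.

(** The curve through the n factors takes time n at speed at most sqrt(m_1) C. It is Lipschitz and
    can fail to be horizontal only at the countably many natural times. *)
Lemma cc_dist_product C n z p : 0 <= C -> horizontal_product G C n z ->
  (cc_dist G p (law G p z) <= (Num.sqrt (m ord0)%:R * C * n%:R)%:E)%E.
Proof.
move=> C0 /(horizontal_product_curve p)[c [c0 cn [K K0 cK] dc]].
have dcZ t : t \in `[0, n%:R] -> ~ range (fun k : nat => k%:R : R) t ->
  exists v, [/\ homogeneous 0 v, `|v| <= C, derivable c t 1 &
        'D_1 c t = left_field G v (c t)].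
  rewrite in_itv /= => /andP[t0 tn] tZ; apply: dc => //.
    by rewrite lt_neqAle t0 andbT; apply/eqP => t0E; apply: tZ; exists 0%N.
  by rewrite lt_neqAle tn andbT; apply/eqP => tnE; apply: tZ; exists n.
apply: (@le_trans _ _ (horizontal_length G 0 n%:R c)).
  apply: ereal_inf_lbound; exists 0, n%:R, c; split=> //; split=> //.
    move=> e e0; exists (e / (K + 1)); first by rewrite divr_gt0 // ltr_wpDl.
    move=> k u v uv _ uve.
    apply: (@le_lt_trans _ _ (K * \sum_i (v i - u i))).
      rewrite mulr_sumr; apply: ler_sum => i _.
      by have [? [? ?]] := uv i; exact: cK.
    have K1 : 0 < K + 1 by rewrite ltr_wpDl.
    move: uve; rewrite ltr_pdivlMr // mulrC; apply: le_lt_trans.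
    rewrite ler_wpM2r // ?lerDl //; apply: sumr_ge0 => i _.
    by have [? [? ?]] := uv i; rewrite subr_ge0.
  exists (range (fun k : nat => k%:R : R)); split.
  - apply: countable_measurable => //; exact: countable_naturals.
  - exact/countable_lebesgue_measure0/countable_naturals.
  - move=> t /=; apply: contra_notP => tZ tn.
    have [v [v0 vC dct ct]] := dcZ t tn tZ; split; first exact: dct.
    rewrite derive1E ct left_field_sum //; apply: memv_suml => k _.
    by apply/memvZ/memv_span/mem_nth; rewrite size_tuple.
apply: le_integral_countable.
- exact: ler0n.
- by rewrite mulr_ge0 // sqrtr_ge0.
- exact: countable_naturals.
- by move=> t; exact: sqrtr_ge0.
move=> t tn tZ; have [v [v0 vC dct ct]] := dcZ t tn tZ.
by rewrite derive1E ct; exact: horizontal_norm_left_field.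
Qed.

Lemma cc_dist_ge0 p q : (0 <= cc_dist G p q)%E.
Proof.
apply: le_ereal_inf_tmp => _ [a [b [c [_ _ _ ->]]]].
by apply: integral_ge0 => t _; rewrite lee_fin sqrtr_ge0.
Qed.

End Curves.

(** * Products of digit vectors *)

Section BinaryExpansions.
Context (R : realType).
Implicit Types b : nat -> bool.

(** The integer with binary digits b_0 ... b_(k-1), the most significant one first. *)
Fixpoint binary b (k : nat) : nat :=
  if k is k'.+1 then (binary b k').*2 + b k' else 0.

Lemma binaryE b k :
  \sum_(0 <= q < k) (b q)%:R / 2 ^+ q.+1 = (binary b k)%:R / 2 ^+ k :> R.
Proof.
elim: k => [|k ih]; first by rewrite big_geq // mul0r.
rewrite big_nat_recr //= ih natrD -mul2n natrM exprS.
by field; rewrite expf_neq0 // pnatr_eq0.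
Qed.

Lemma binary_inj b b' k : binary b k = binary b' k ->
  forall q, (q < k)%N -> b q = b' q.
Proof.
elim: k => [//|k ih] /= E.
have bk : b k = b' k.
  by have := congr1 odd E; rewrite !oddD !odd_double; case: (b k) (b' k) => [] [].
have {}ih : forall q, (q < k)%N -> b q = b' q.
  by apply: ih; move: E; rewrite bk => /addIn /double_inj.
by move=> q; rewrite ltnS leq_eqVlt => /predU1P[->//|]; exact: ih.
Qed.

(** The common digits cancel, so the sums differ by a multiple of 2^-k with k = min(h, Q). Being
    less than 2^-h <= 2^-k in absolute value, the difference is 0. *)
Lemma binary_separated b b' h Q : (forall q, (h <= q)%N -> b q = b' q) ->
  `|\sum_(0 <= q < Q) (b q)%:R / 2 ^+ q.+1
    - \sum_(0 <= q < Q) (b' q)%:R / 2 ^+ q.+1 : R| < 2^-1 ^+ h ->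
  forall q, (q < Q)%N -> b q = b' q.
Proof.
move=> bb'; pose k := minn h Q.
have kQ : (k <= Q)%N by exact: geq_minr.
have tailE : \sum_(k <= q < Q) (b q)%:R / 2 ^+ q.+1 =
    \sum_(k <= q < Q) (b' q)%:R / 2 ^+ q.+1 :> R.
  apply: eq_big_nat => q /andP[kq qQ]; rewrite bb' //.
  by move: kq; rewrite /k geq_min leqNgt [(Q <= q)%N]leqNgt qQ orbF -leqNgt.
rewrite !(big_cat_nat (leq0n k) kQ) /= tailE opprD addrACA subrr addr0.
rewrite !binaryE -mulrBl normrM normfV [`|2 ^+ k|]ger0_norm ?exprn_ge0 //.
rewrite ltr_pdivrMr ?exprn_gt0 // => lt1.
have : `|(binary b k)%:R - (binary b' k)%:R : R| < 1.
  apply: (lt_le_trans lt1); rewrite exprVn mulrC ler_pdivrMr ?exprn_gt0 // mul1r.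
  by rewrite ler_eXn2l ?geq_minl // ltr1n.
rewrite ltr_norml => /andP[l1 l2].
have E : binary b k = binary b' k.
  by apply/eqP; rewrite eqn_leq; apply/andP; split;
    rewrite -ltnS -(ltr_nat R) -natr1; lra.
move=> q qQ; have [hq|qh] := leqP h q; first exact: bb'.
by apply: (binary_inj E); rewrite /k leq_min qh.
Qed.

Lemma geometric_sum_le (a b : nat) : (a <= b)%N ->
  \sum_(a <= q < b) (2 ^+ q.+1)^-1 <= (2 ^+ a)^-1 :> R.
Proof.
move=> ab.
suff -> : \sum_(a <= q < b) (2 ^+ q.+1)^-1 = (2 ^+ a)^-1 - (2 ^+ b)^-1 :> R.
  by rewrite gerBl invr_ge0 exprn_ge0.
rewrite -opprB -(telescope_sumr (fun q => (2 ^+ q)^-1)) // -sumrN.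
apply: eq_bigr => q _; rewrite exprS.
by field; rewrite expf_neq0 // pnatr_eq0.
Qed.

End BinaryExpansions.

Section Digits.
Context (R : realType) (s : nat) (m : 'I_s.+1 -> nat) (G : carnot_group R m).
Local Notation V := (coords R m).
Local Notation index := 'I_(\sum_j m j).
Implicit Types D : index -> nat -> bool.

(** [D i q] is the binary digit of value 2^-(q+1) of the coordinate i; with w = [(weight i).+1], w
    consecutive ones form a digit in base 2^w. *)
Definition digit_block D (k : nat) : V :=
  \row_i \sum_((weight i).+1 * k <= q < (weight i).+1 * k.+1)
    (D i q)%:R / 2 ^+ q.+1.

Fixpoint partial_product D (n : nat) : V :=
  if n is n'.+1 then law G (partial_product D n') (digit_block D n') else 0.

Fixpoint tail_product D (n k : nat) : V :=
  if k is k'.+1 then law G (digit_block D n) (tail_product D n.+1 k') else 0.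

Lemma partial_productD D n k :
  partial_product D (n + k) = law G (partial_product D n) (tail_product D n k).
Proof.
elim: k n => [|k ih] n; first by rewrite addn0 /= lawx0.
by rewrite addnS -addSn ih /= lawA.
Qed.

Lemma digit_block_ext D D' k :
  (forall i q, (q < (weight i).+1 * k.+1)%N -> D i q = D' i q) ->
  digit_block D k = digit_block D' k.
Proof.
move=> DD'; apply/rowP => i; rewrite !mxE.
by apply: eq_big_nat => q /andP[_ qk]; rewrite DD'.
Qed.

Lemma partial_product_ext D D' n :
  (forall i q, (q < (weight i).+1 * n)%N -> D i q = D' i q) ->
  partial_product D n = partial_product D' n.
Proof.
elim: n => [//|n ih] DD' /=; rewrite ih; last first.
  by move=> i q qn; apply: DD'; apply: leq_trans qn _; rewrite leq_mul.
by congr (law G _ _ : V); exact: digit_block_ext.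
Qed.

(** Zero digits give factors equal to the identity; thus a product can be lengthened at will. *)
Lemma partial_product_padding D n k :
  partial_product (fun i q => D i q && (q < (weight i).+1 * n)%N) (n + k) =
  partial_product D n.
Proof.
pose D' i q := D i q && (q < (weight i).+1 * n)%N; rewrite -/D'.
suff tail0 l : (n <= l)%N -> tail_product D' l k = 0.
  rewrite partial_productD tail0 // lawx0.
  by apply: partial_product_ext => i q qn; rewrite /D' qn andbT.
elim: k l => [//|k ih] l nl /=.
rewrite ih ?(leq_trans nl) // lawx0; apply/rowP => i; rewrite !mxE.
rewrite big_nat_cond big1 // => q /andP[/andP[lq _] _].
by rewrite /D' ltnNge (leq_trans _ lq) ?leq_mul // andbF mul0r.
Qed.

Lemma digit_block_bound D n : `|dilation (2 ^+ n) (digit_block D n)| <= 1.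
Proof.
apply: norm_le_coord => // i; rewrite !mxE -exprM mulnC.
set w := (weight i).+1.
have wn : (w * n <= w * n.+1)%N by rewrite leq_mul.
rewrite normrM ger0_norm ?exprn_ge0 // mulrC -ler_pdivlMr ?exprn_gt0 // div1r.
apply: le_trans (geometric_sum_le R wn).
apply: (le_trans (ler_norm_sum _ _ _)); apply: ler_sum => q _.
rewrite ger0_norm ?divr_ge0 ?exprn_ge0 // ler_piMl ?invr_ge0 ?exprn_ge0 //.
by case: (D i q).
Qed.

Lemma tail_productS D n k :
  dilation (2 ^+ n) (tail_product D n k.+1) =
  law G (dilation (2 ^+ n) (digit_block D n))
    (dilation 2^-1 (dilation (2 ^+ n.+1) (tail_product D n.+1 k))).
Proof.
by rewrite /= dilation_law; congr (law G _ _ : V); rewrite dilationM exprS mulKf.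
Qed.

(** The rescaled tails satisfy T_n = a_n * dilation_(1/2) T_(n+1), with a_n the rescaled block. A
    coordinate of T_n in the layer j is the one of T_(n+1) multiplied by at most 1/2, plus one of
    a_n, at most 1, plus a function of the lower layers, bounded by C by induction. This preserves
    the bound 2 (1 + C). *)
Lemma tail_product_bound : exists2 rho : R, 0 <= rho &
  forall D n k, `|dilation (2 ^+ n) (tail_product D n k)| <= rho.
Proof.
suff /(_ s.+1)[rho rho0 tr] : forall j, exists2 rho : R, 0 <= rho &
    forall D n k i, (weight i < j)%N ->
    `|dilation (2 ^+ n) (tail_product D n k) 0 i| <= rho.
  exists rho => // D n k; apply: norm_le_coord => // i.
  by apply: tr; rewrite ltnS weight_le.
elim=> [|j [rho rho0 tr]]; first by exists 0.
have [C C0 lawC] := law_bounded G (Num.max 1 rho).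
have C1 : 0 <= 2 * (1 + C) by rewrite mulr_ge0 // addr_ge0.
exists (Num.max rho (2 * (1 + C))); first by rewrite le_max rho0.
move=> D n k i; rewrite ltnS leq_eqVlt => /predU1P[ij|]; last first.
  by move=> ij; rewrite le_max tr.
rewrite le_max; apply/orP; right.
elim: k n => [|k ih] n; first by rewrite linear0 mxE normr0.
rewrite tail_productS; set p := dilation _ (digit_block _ _).
set z := dilation 2^-1 _.
(* [low] erases the layers >= j, on which the nonlinear part of the layer j does not depend. *)
pose low (x : V) : V := \row_i (if (weight i < j)%N then x 0 i else 0).
have lowP x : filtered j (x - low x).
  by move=> l lj; rewrite !mxE lj subrr.
have low0 x : low x 0 i = 0 by rewrite mxE ij ltnn.
have -> : law G p z 0 i = law G (low p) (low z) 0 i + z 0 i + p 0 i.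
  have := law_filtered_congr G (lowP p) (lowP z).
  move=> /(_ i); rewrite ij ltnSn => /(_ isT); move: (low0 p) (low0 z).
  move: (low p) (low z) => lp lz lp0 lz0; clearbody p z; rewrite !mxE lp0 lz0 !subr0.
  by move/eqP; rewrite subr_eq0 => /eqP <-; rewrite !subrK.
have zi : `|z 0 i| <= 2^-1 * (2 * (1 + C)).
  rewrite mxE normrM ger0_norm ?exprn_ge0 //.
  apply: ler_pM; rewrite ?exprn_ge0 // exprS ler_piMr // exprn_ile1 //.
  by rewrite invf_le1 // ler1n.
have pi1 : `|p 0 i| <= 1.
  exact: le_trans (coord_le_norm _ _) (digit_block_bound _ _).
have lC : `|law G (low p) (low z) 0 i| <= C.
  apply: le_trans (coord_le_norm _ _) _; apply: lawC.
    rewrite le_max; apply/orP; left; apply: norm_le_coord => // l.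
    rewrite mxE; case: ifP => _; last by rewrite normr0.
    exact: le_trans (coord_le_norm _ _) (digit_block_bound _ _).
  rewrite le_max; apply/orP; right; apply: norm_le_coord => // l.
  rewrite mxE; case: ifP => lj; last by rewrite normr0.
  rewrite mxE normrM ger0_norm ?exprn_ge0 //.
  apply: le_trans (tr D n.+1 k l lj); rewrite ler_piMl // exprn_ile1 //.
  by rewrite invf_le1 // ler1n.
rewrite mulKf // in zi.
have -> : 2 * (1 + C) = (C + (1 + C)) + 1 by ring.
apply: (le_trans (ler_normD _ _)); apply: lerD => //.
by apply: (le_trans (ler_normD _ _)); exact: lerD.
Qed.

(** Induction on n with [law_filtered_congr]. By the second conclusion, a product is in the layer j
    the sum of its blocks plus a function of the layers below j. *)
Lemma partial_product_congr j D D' n :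
  (forall k, (k < n)%N -> filtered j (digit_block D k - digit_block D' k)) ->
  filtered j (partial_product D n - partial_product D' n) /\
  filtered j.+1 ((partial_product D n - \sum_(k < n) digit_block D k)
    - (partial_product D' n - \sum_(k < n) digit_block D' k)).
Proof.
elim: n => [|n ih] DD'.
  by rewrite !big_ord0 !subrr; split; exact: filteredz.
have [|g1 g2] := ih; first by move=> k kn; apply: DD'; rewrite ltnS ltnW.
have dn := DD' n (ltnSn n).
have L := law_filtered_congr G g1 dn.
have F : filtered j.+1 ((partial_product D n.+1 - \sum_(k < n.+1) digit_block D k)
    - (partial_product D' n.+1 - \sum_(k < n.+1) digit_block D' k)).
  rewrite /= !(big_ord_recr n) /=.
  move: L g2; set S := \sum_(_ < n) digit_block D _; set S' := \sum_(_ < n) _.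
  set u := law G _ _; set v := law G _ _ => L g2.
  rewrite (_ : _ - _ = (u - partial_product D n - digit_block D n
      - (v - partial_product D' n - digit_block D' n))
    + ((partial_product D n - S) - (partial_product D' n - S'))).
    exact: filteredD.
  by apply/rowP => i; rewrite !mxE; ring.
split=> //.
rewrite (_ : _ - _ = ((partial_product D n.+1 - \sum_(k < n.+1) digit_block D k)
    - (partial_product D' n.+1 - \sum_(k < n.+1) digit_block D' k))
    + \sum_(k < n.+1) (digit_block D k - digit_block D' k)).
  apply: filteredD; first exact: filtered_leq F.
  by apply: filtered_sum => k _; exact: DD'.
by rewrite sumrB; apply/rowP => i; rewrite !mxE; ring.
Qed.

Lemma sum_digit_block D n i : (\sum_(k < n) digit_block D k) 0 i =
  \sum_(0 <= q < (weight i).+1 * n) (D i q)%:R / 2 ^+ q.+1.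
Proof.
elim: n => [|n ih]; first by rewrite big_ord0 muln0 big_geq // mxE.
rewrite (big_ord_recr n) /= mxE ih mxE -big_cat_nat //.
by rewrite leq_mul.
Qed.

(** Induction on the layers. Once the digits in the lower layers agree, a coordinate of the
    difference of the products is a difference of two binary sums, and [binary_separated]
    applies. *)
Lemma partial_product_separated D D' n h :
  (forall i q, (h <= q)%N -> D i q = D' i q) ->
  `|partial_product D n - partial_product D' n| < 2^-1 ^+ h ->
  forall i q, (q < (weight i).+1 * n)%N -> D i q = D' i q.
Proof.
move=> DD' gg'; suff low j i : (weight i < j)%N ->
    forall q, (q < (weight i).+1 * n)%N -> D i q = D' i q.
  by move=> i; apply: (low s.+1); rewrite ltnS weight_le.
elim: j i => [//|j ih] i; rewrite ltnS leq_eqVlt => /predU1P[ij|]; last exact: ih.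
apply: (@binary_separated R _ _ h _ (DD' i)).
rewrite -!sum_digit_block.
have [|_ /(_ i)] := @partial_product_congr j D D' n.
  move=> k kn l lj; rewrite !mxE; apply/eqP; rewrite subr_eq0; apply/eqP.
  apply: eq_big_nat => q /andP[_ qk]; rewrite (ih _ lj) //.
  by apply: leq_trans qk _; rewrite leq_mul.
rewrite ij ltnSn => /(_ isT) E.
have -> : (\sum_(k < n) digit_block D k) 0 i - (\sum_(k < n) digit_block D' k) 0 i =
    (partial_product D n - partial_product D' n) 0 i.
  move: E; rewrite !mxE => E; apply/eqP.
  by rewrite eq_sym -subr_eq0 -{}E; apply/eqP; ring.
exact: le_lt_trans (coord_le_norm _ _) gg'.
Qed.

End Digits.

(** * The compact set of digit products and its tiles *)

Section Fractal.
Context (R : realType) (s : nat) (m : 'I_s.+1 -> nat) (G : carnot_group R m).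
Local Notation V := (coords R m).
Local Notation index := 'I_(\sum_j m j).
Context (free : index -> nat -> bool).
Implicit Types D : index -> nat -> bool.

Definition fractal : set V :=
  closure [set x | exists D n, (forall i q, D i q -> free i q)
    /\ partial_product G D n = x].

(** A word is the set of the positions carrying the digit 1. Since weights are at most s, n factors
    only use positions below n (s + 1). *)
Local Notation word n := {set index * 'I_(n * s.+1)}.

Definition digits_of n (W : word n) (i : index) (q : nat) : bool :=
  if insub q is Some q' then (i, q') \in W else false.

Lemma digits_of_ord n (W : word n) i (q : 'I_(n * s.+1)) :
  digits_of W i q = ((i, q) \in W).
Proof. by rewrite /digits_of valK. Qed.

Definition positions n : word n :=
  finset (fun p : index * 'I_(n * s.+1) =>
    (p.2 < (weight p.1).+1 * n)%N && free p.1 p.2).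

Lemma position_lt (i : index) n q : (q < (weight i).+1 * n -> q < n * s.+1)%N.
Proof. by move=> /leq_trans; apply; rewrite mulnC leq_mul // ltnS weight_le. Qed.

Lemma digits_of_positions n (W : word n) i q : W \subset positions n ->
  digits_of W i q -> (q < (weight i).+1 * n)%N && free i q.
Proof.
move=> /fintype.subsetP WP; rewrite /digits_of; case: insubP => [q' _ <-|//].
by move=> /WP; rewrite inE.
Qed.

Lemma word_of D n : (forall i q, D i q -> free i q) ->
  exists2 W : word n, W \subset positions n &
    partial_product G (digits_of W) n = partial_product G D n.
Proof.
move=> Df; exists (positions n :&:
  finset (fun p : index * 'I_(n * s.+1) => D p.1 p.2)).
  exact: finset.subsetIl.
apply: partial_product_ext => i q qn.
rewrite -[q]/(val (Ordinal (position_lt qn))) digits_of_ord !inE /= qn /=.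
by case: (boolP (D i q)) => [/Df->|]; rewrite ?andbF.
Qed.

(** The left translate, by a product of n factors, of the ball of radius rho shrunk by
    dilation_(2^-n). *)
Definition tile (rho : R) n D : set V :=
  [set x | `|dilation (2 ^+ n) (law G (- partial_product G D n) x)| <= rho].

Lemma closed_tile rho n D : closed (tile rho n D).
Proof.
rewrite /tile -[X in closed X]/((fun x => `|dilation (2 ^+ n)
  (law G (- partial_product G D n) x)|) @^-1` [set y | y <= rho]).
apply: (preimage_closed _ (@closed_le _ _)) => x _.
apply: (@continuous_comp _ _ _ (fun x => dilation (2 ^+ n)
  (law G (- partial_product G D n) x)) (fun y : V => `|y|)).
  apply: continuous_comp; first exact: continuous_law.
  exact: continuous_dilation.
exact: norm_continuous.
Qed.

Section Tiles.
Context (rho : R) (tail_le : forall D n k,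
  `|dilation (2 ^+ n) (tail_product G D n k)| <= rho).

Lemma partial_product_tile D n k : tile rho n D (partial_product G D (n + k)).
Proof. by rewrite /tile /= partial_productD lawK. Qed.

(** The tiles are closed and finite in number, so it suffices to cover the products themselves. The
    first n factors of a product determine a tile containing it, because the rescaled tail is
    bounded by rho. *)
Lemma fractal_cover n :
  fractal `<=` \bigcup_(W in [set W : word n | W \subset positions n])
    tile rho n (digits_of W).
Proof.
set T := \bigcup_(_ in _) _; have Tc : closed T.
  apply: closed_bigcup => [|W _]; last exact: closed_tile.
  exact: finite_finset.
rewrite /fractal (iffLR (closure_id _) Tc); apply: closureS => x [D [k [Df <-]]].
(* With the digits cut off after k factors, the product of n + k factors equals the given one of k
   factors, even if k < n. *)
pose D' i q := D i q && (q < (weight i).+1 * k)%N.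
have [W WP Wn] := @word_of D' n (fun i q h => Df i q (andP h).1).
exists W => //; have := @partial_product_tile D' n k.
by rewrite /tile /= Wn addnC partial_product_padding.
Qed.

Lemma compact_fractal : compact fractal.
Proof.
apply: bounded_closed_compact; last exact: closed_closure.
exists rho; split; first exact: num_real.
(* Every tile of level 0 is the ball of radius rho. *)
move=> M rM x /(@fractal_cover 0)[W _]; rewrite /tile /= expr0 dilation1.
by rewrite oppr0 law0x => /le_trans; apply; exact: ltW.
Qed.

(** The element x^-1 * y is the image under dilation_(2^-n) of a^-1 * b with a, b in the ball of
    radius rho. The latter is bounded, hence a product of N bounded horizontal factors, whose norms
    the dilation multiplies by 2^-n. *)
Lemma tile_cc_dist : exists2 C : R, 0 <= C & forall n D x y,
  tile rho n D x -> tile rho n D y -> (cc_dist G x y <= (C / 2 ^+ n)%:E)%E.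
Proof.
have [E E0 lawE_] := law_bounded G rho.
have [C [N CN]] := bounded_reachable G E.
have C0 : 0 <= C.
  by have [|_] := CN 0; [rewrite /= normr0|rewrite normr0].
exists (Num.sqrt (m ord0)%:R * C * N%:R); first by rewrite !mulr_ge0 ?sqrtr_ge0.
move=> n D x y; rewrite /tile /=.
set g := partial_product G D n; set a := dilation _ (law G _ x).
set b := dilation _ (law G _ y) => ar br.
have [|abN _] := CN (law G (- a) b); first by apply: lawE_; rewrite ?normrN.
have abE : law G (- a) b = dilation (2 ^+ n) (law G (- x) y).
  rewrite /a /b -linearN -dilation_law oppr_law opprK -lawA.
  by rewrite [law G g _]lawA lawxN law0x.
have t0 : 0 <= (2 ^+ n)^-1 :> R by rewrite invr_ge0 exprn_ge0.
have := horizontal_product_dilation t0 abN.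
rewrite abE dilationM mulVf ?expf_neq0 ?pnatr_eq0 // dilation1.
move=> /(cc_dist_product x); rewrite lawNK mulr_ge0 // => /(_ isT).
by rewrite (mulrC _ C) mulrA [in X in _ -> X]mulrAC.
Qed.

End Tiles.

(** By [partial_product_separated], the words in question are determined by their digits from
    position h on. *)
Lemma card_separated (n h : nat) (O : set V) :
  (forall x y, O x -> O y -> `|x - y| < 2^-1 ^+ h) ->
  (#|finset (fun W : word n => (W \subset positions n)
        && `[< O (partial_product G (digits_of W) n) >])|
    <= 2 ^ #|finset (fun p : index * 'I_(n * s.+1) =>
               (p \in positions n) && (h <= p.2)%N)|)%N.
Proof.
move=> Oh; set S := finset _; set H := finset _.
pose r (W : word n) : word n := W :&:
  finset (fun p : index * 'I_(n * s.+1) => (h <= p.2)%N).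
rewrite -card_powerset -(@card_in_imset _ _ r).
  apply/subset_leq_card/fintype.subsetP => _ /imsetP[W + ->].
  rewrite inE => /andP[WP _]; rewrite powersetE /r; apply/fintype.subsetP => p.
  rewrite !inE => /andP[/(fintype.subsetP WP)].
  by rewrite inE => ->.
move=> W W'; rewrite !inE => /andP[WP /asboolP OW] /andP[WP' /asboolP OW'] rWW'.
have WW' i q : (h <= q)%N -> digits_of W i q = digits_of W' i q.
  move=> hq; rewrite /digits_of; case: insubP => // q' _ q'E.
  by have /finset.setP/(_ (i, q')) := rWW'; rewrite !inE /= q'E hq !andbT.
have E := partial_product_separated WW' (Oh _ _ OW OW').
apply/finset.setP => -[i q]; rewrite -!digits_of_ord.
have [qn|nq] := ltnP q ((weight i).+1 * n); first exact: E.
apply/idP/idP => /digits_of_positions; [move=> /(_ WP)|move=> /(_ WP')];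
  by rewrite ltnNge nq.
Qed.

End Fractal.

(** * Bounds of Hausdorff measures *)

Section HausdorffBounds.
Context (R : realType).

Lemma hausdorff_weight_ge0 (T : Type) (d : T -> T -> \bar R) a (A : set T) :
  (0 <= hausdorff_weight d a A)%E.
Proof. by rewrite /hausdorff_weight; case: ifP => // _; exact: poweR_ge0. Qed.

Lemma half_expn_small (c e : R) :
  0 <= c -> 0 < e -> exists n : nat, c * 2^-1 ^+ n <= e.
Proof.
move=> c0 e0; exists (Num.bound (c / e)).
rewrite exprVn ler_pdivrMr ?exprn_gt0 // mulrC -ler_pdivrMr //.
apply: (le_trans (ltW (archi_boundP _))); first by rewrite divr_ge0 // ltW.
by rewrite -natrX ler_nat ltnW // ltn_expl.
Qed.

(** The cover of level n has total weight at most 2^(n b) (c / 2^n)^b = c^b. *)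
Lemma hausdorff_measure_le (T : Type) (d : T -> T -> \bar R) (c b : R) (K : set T) :
  0 <= c -> 0 <= b -> (forall x y, 0 <= d x y)%E ->
  (forall n : nat, exists (I : finType) (U : I -> set T),
    [/\ K `<=` \bigcup_i U i,
        forall i x y, U i x -> U i y -> (d x y <= (c / 2 ^+ n)%:E)%E &
        #|I|%:R <= (2 ^+ n) `^ b]) ->
  (hausdorff_measure d b K <= (c `^ b)%:E)%E.
Proof.
move=> c0 b0 d0 cover; apply: ge_ereal_sup => _ [delta /= delta0 <-].
have [n] := half_expn_small c0 delta0; rewrite exprVn => cn.
have [I [U [KU dU cardI]]] := cover n.
have cn0 : 0 <= c / 2 ^+ n by rewrite divr_ge0 // exprn_ge0.
(* The finite cover is completed to a sequence by empty sets, of weight 0. *)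
pose U' k : set T := if insub k is Some i then U (enum_val (i : 'I_#|I|)) else set0.
have diamU' k : (diam d (U' k) <= (c / 2 ^+ n)%:E)%E.
  apply: ge_ereal_sup => _ [[x y] /= [Ux Uy] <-]; move: Ux Uy; rewrite /U' /=.
  by case: insubP => // i _ _; exact: dU.
apply: ge_ereal_inf; exists (\sum_(0 <= k <oo) hausdorff_weight d b (U' k))%E.
  exists U' => //; split; last first.
    by move=> k; apply: (le_trans (diamU' k)); rewrite lee_fin.
  move=> x /KU[i _ Uix]; exists (enum_rank i) => //.
  by rewrite /U' valK enum_rankK.
rewrite (nneseries_split 0 #|I|); last by move=> *; exact: hausdorff_weight_ge0.
rewrite [X in (_ + X)%E]eseries0 ?adde0; last first.
  move=> k; rewrite add0n => kI _; rewrite /hausdorff_weight ifT //.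
  by rewrite /U' insubF ?eqxx // ltnNge kI.
apply: (@le_trans _ _ (\sum_(0 <= k < 0 + #|I|) ((c / 2 ^+ n) `^ b)%:E)%E).
  apply: lee_sum => k _; rewrite /hausdorff_weight; case: ifPn => [_|/set0P[x Ux]].
    by rewrite lee_fin powR_ge0.
  have diam0 : (0 <= diam d (U' k))%E.
    by apply: le_trans (d0 x x) _; apply: ereal_sup_ubound; exists (x, x).
  rewrite -poweR_EFin; apply: gt0_ler_poweR => //.
    by rewrite in_itv /= diam0 leey.
  by rewrite in_itv /= lee_fin cn0 leey.
rewrite sumEFin lee_fin sumr_const_nat add0n subn0 -[leLHS]mulr_natl.
rewrite -[in leRHS](divfK (x := 2 ^+ n) _ c) ?expf_neq0 ?pnatr_eq0 //.
by rewrite [in leRHS]powRM ?exprn_ge0 // mulrC ler_wpM2l ?powR_ge0.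
Qed.

(** For a positive diameter r, q is chosen with 2^-(q+3) <= r < 2^-(q+2), whence 2^-q <= 8 r. The
    error e serves for the empty set and for r = 0, where q is taken large. The exponent q + 2
    leaves room for enlarging A to an open set. *)
Lemma small_diameter (n : nat) (d : 'rV[R]_n -> 'rV[R]_n -> \bar R) (a e : R)
    (A : set 'rV[R]_n) :
  0 < a -> 0 < e -> (forall x y, `|x - y|%:E <= d x y)%E ->
  (diam d A <= (8^-1)%:E)%E ->
  exists q : nat, (forall x y, A x -> A y -> `|x - y| < 2^-1 ^+ q.+2) /\
    (((2^-1 ^+ q) `^ a)%:E <= (8 `^ a)%:E * hausdorff_weight d a A + e%:E)%E.
Proof.
move=> a0 e0 dnorm diamA.
have [q0 q0e] : exists q : nat, (2^-1 ^+ q) `^ a <= e.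
  have e'0 : 0 < e `^ a^-1 by rewrite powR_gt0.
  have [q] := half_expn_small ler01 e'0; rewrite mul1r => qe; exists q.
  rewrite [leRHS](_ : e = (e `^ a^-1) `^ a); last first.
    by rewrite -powRrM mulVf ?lt0r_neq0 // powRr1 // ltW.
  by apply: (ge0_ler_powR (ltW a0)); rewrite ?nnegrE ?exprn_ge0 ?powR_ge0.
have w0 := hausdorff_weight_ge0 d a A.
have small :
    (((2^-1 ^+ q0) `^ a)%:E <= (8 `^ a)%:E * hausdorff_weight d a A + e%:E)%E.
  apply: (@le_trans _ _ e%:E); first by rewrite lee_fin.
  by rewrite leeDr // mule_ge0 // lee_fin powR_ge0.
have [A0|/set0P[x0 Ax0]] := eqVneq A set0.
  by exists q0; split=> // x y; rewrite A0.
have dle x y : A x -> A y -> (`|x - y|%:E <= diam d A)%E.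
  move=> Ax Ay; apply: (le_trans (dnorm x y)).
  by apply: ereal_sup_ubound; exists (x, y).
have diam0 : (0 <= diam d A)%E.
  by apply: le_trans (dle x0 x0 Ax0 Ax0); rewrite lee_fin.
have dfin : diam d A \is a fin_num.
  by rewrite ge0_fin_numE //; apply: le_lt_trans diamA _; rewrite ltry.
have wE : hausdorff_weight d a A = (fine (diam d A) `^ a)%:E.
  rewrite /hausdorff_weight ifF; last by apply/negbTE/set0P; exists x0.
  by rewrite -poweR_EFin fineK.
set r := fine (diam d A) in wE.
have rE : diam d A = r%:E by rewrite fineK.
rewrite rE lee_fin in diamA; rewrite rE lee_fin in diam0.
have {}dle x y : A x -> A y -> `|x - y| <= r.
  by move=> Ax Ay; rewrite -lee_fin -rE dle.
have [r0|r0] := eqVneq r 0.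
  exists q0; split=> // x y Ax Ay; apply: (le_lt_trans (dle x y Ax Ay)).
  by rewrite r0 exprn_gt0.
have {}r0 : 0 < r by rewrite lt_neqAle eq_sym r0.
have exq : exists q : nat, 2^-1 ^+ q.+2 <= r.
  have [q qr] := half_expn_small ler01 r0; exists q; rewrite mul1r in qr.
  apply: le_trans qr; rewrite 2!exprS mulrA ler_piMl ?exprn_ge0 //; lra.
(* The least exponent is not 0, as r <= 1/8 < 1/4; its predecessor is the required q. *)
case: (ex_minnP exq) => -[|q] qr qmin.
  by exfalso; move: qr; rewrite expr2; lra.
have rq : r < 2^-1 ^+ q.+2.
  by rewrite ltNge; apply/negP => /qmin; rewrite ltnn.
exists q; split; first by move=> x y Ax Ay; exact: le_lt_trans (dle x y Ax Ay) rq.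
rewrite wE -EFinM -EFinD lee_fin -powRM ?(ltW r0) //.
rewrite -[leLHS]addr0 lerD ?(ltW e0) //.
apply: (ge0_ler_powR (ltW a0)); rewrite ?nnegrE ?exprn_ge0 ?mulr_ge0 ?(ltW r0) //.
by move: qr; rewrite !exprS; lra.
Qed.

(* Counting measures on finite subsets of K play the role of a Frostman measure:
   by compactness only finitely many sets of a cover matter.                 *)
Lemma hausdorff_measure_gt0 (n : nat) (d : 'rV[R]_n -> 'rV[R]_n -> \bar R)
    (a C : R) (K : set 'rV[R]_n) :
  0 < a -> 0 < C -> (forall x y, `|x - y|%:E <= d x y)%E -> compact K ->
  (forall l : nat, exists (I : finType) (g : I -> 'rV[R]_n),
    [/\ (0 < #|I|)%N, forall i, K (g i) &
      forall (h : nat) (O : set 'rV[R]_n), (h <= l)%N ->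
        (forall x y, O x -> O y -> `|x - y| < 2^-1 ^+ h) ->
        #|[pred i | `[< O (g i) >]]|%:R <= C * (2^-1 ^+ h) `^ a * #|I|%:R]) ->
  (0 < hausdorff_measure d a K)%E.
Proof.
(* For the total weight W of a cover by sets of diameter at most 1/8, the inequality 1 <= C (8^a W +
   e) with C e = 1/2 will give W >= c. *)
move=> a0 C0 dnorm Kc mass; set c := (2 * C * 8 `^ a)^-1.
have c0 : 0 < c by rewrite invr_gt0 !mulr_gt0 // powR_gt0.
apply: (@lt_le_trans _ _ c%:E); first by rewrite lte_fin.
apply: (@le_trans _ _ (hausdorff_premeasure d a 8^-1 K)); last first.
  by apply: ereal_sup_ubound; exists 8^-1 => //=; rewrite invr_gt0 ltr0n.
apply: le_ereal_inf_tmp => _ [U [KU dU] <-].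
pose e : R := (2 * C)^-1; have e0 : 0 < e by rewrite invr_gt0 mulr_gt0.
have ek0 k : 0 < e / (2 ^ k.+1)%:R by rewrite divr_gt0 // ltr0n expn_gt0.
have [q qU] := choice (fun k => small_diameter a0 (ek0 k) dnorm (dU k)).
(* Enlarged by balls of radius 2^-(q k + 2), the sets become open, and their points remain at
   distance less than 3/4 of 2^-(q k). *)
pose O k := \bigcup_(y in U k) ball y (2^-1 ^+ (q k).+2 : R).
have Oopen k : open (O k) by apply: bigcup_open => y _; exact: ball_open.
have Osep k x y : O k x -> O k y -> `|x - y| < 2^-1 ^+ q k.
  move=> [x' Ux']; rewrite -ball_normE /= => xx' [y' Uy'].
  rewrite -ball_normE /= => yy'.
  have xy' := (qU k).1 x' y' Ux' Uy'.
  rewrite (_ : x - y = (x - x') + (x' - y') + (y' - y)); last first.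
    by rewrite subrKA addrA subrK.
  apply: (le_lt_trans (ler_normD _ _)).
  apply: (le_lt_trans (lerD (ler_normD _ _) (lexx _))).
  rewrite distrC; move: xx' xy' yy'; rewrite !exprS.
  have : 0 < 2^-1 ^+ q k :> R by rewrite exprn_gt0.
  by move: (_ ^+ q k) `|_| `|_| `|_| => u v w z; lra.
move: Kc; rewrite compact_cover => /(_ nat setT O (fun k _ => Oopen k)).
case=> [x /KU[k _ Ux]|D' _ KD'].
  by exists k => //; exists x => //; apply: ballxx; rewrite exprn_gt0.
(* N exceeds the indices of the finite subcover and l bounds their scales, so the count at level l
   applies to every O k with k < N. *)
pose N := (\max_(k <- finmap.enum_fset D') k).+1; pose l := (\max_(k < N) q k)%N.
have [I [g [I0 Kg gO]]] := mass l.
have cardI : (#|I| <= \sum_(k < N) #|[pred i | `[< O k (g i) >]]|)%N.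
  rewrite -sum1_card (eq_bigr (fun k : 'I_N =>
    \sum_(i : I) (if `[< O k (g i) >] then 1 else 0))%N); last first.
    by move=> k _; rewrite -sum1_card big_mkcond.
  rewrite exchange_big /=; apply: leq_sum => i _.
  have [k /= kD' Ok] := KD' _ (Kg i).
  have kN : (k < N)%N by rewrite ltnS; exact: leq_bigmax_seq.
  by rewrite (bigD1 (Ordinal kN)) //= asboolT.
have C_sum : 1 <= C * \sum_(k < N) (2^-1 ^+ q k) `^ a.
  rewrite -(ler_pM2r (x := #|I|%:R)) ?ltr0n // mul1r.
  apply: (le_trans (_ : _ <= (\sum_(k < N) #|[pred i | `[< O k (g i) >]]|)%N%:R)).
    by rewrite ler_nat.
  rewrite natr_sum mulr_sumr mulr_suml; apply: ler_sum => k _.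
  by apply: gO; [rewrite /l (leq_bigmax k)|exact: Osep].
have w0 k : (0 <= hausdorff_weight d a (U k))%E by exact: hausdorff_weight_ge0.
set W := (\sum_(0 <= k <oo) _)%E.
have W0 : (0 <= W)%E by apply: nneseries_ge0.
have sumW : ((\sum_(k < N) (2^-1 ^+ q k) `^ a)%:E <= (8 `^ a)%:E * W + e%:E)%E.
  apply: (@le_trans _ _ (\sum_(k < N) ((8 `^ a)%:E * hausdorff_weight d a (U k)
      + (e / (2 ^ k.+1)%:R)%:E))%E).
    by rewrite -sumEFin; apply: lee_sum => k _; exact: (qU k).2.
  rewrite big_split /= -ge0_sume_distrr //; apply: leeD.
    rewrite lee_wpmul2l ?lee_fin ?powR_ge0 //.
    rewrite -(big_mkord xpredT (fun k => hausdorff_weight d a (U k))).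
    exact: nneseries_lim_ge.
  apply: le_trans (epsilon_trick0 xpredT (ltW e0)).
  rewrite -(big_mkord xpredT (fun k => (e / (2 ^ k.+1)%:R)%:E)).
  by apply: nneseries_lim_ge => k _ _; rewrite lee_fin ltW.
have [Wfin|] := boolP (W \is a fin_num); last first.
  by rewrite ge0_fin_numE // -leNgt leye_eq => /eqP ->; rewrite leey.
move: sumW; rewrite -(fineK Wfin) -EFinM -EFinD !lee_fin => sumW.
have {}sumW := le_trans C_sum (ler_wpM2l (ltW C0) sumW).
have : 2^-1 <= C * (8 `^ a * fine W).
  have eC : C * e = 2^-1 by rewrite /e; field; exact: lt0r_neq0.
  by move: sumW; rewrite mulrDr eC; lra.
move=> half; rewrite /c -[leLHS]div1r ler_pdivrMr ?mulr_gt0 ?powR_gt0 //.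
by rewrite (_ : _ * (_ * _) = 2 * (C * (8 `^ a * fine W))); [lra|ring].
Qed.

End HausdorffBounds.

(** * Distribution of the dimension among the coordinates *)

Section Dimensions.
Context (R : realType) (s : nat) (m : 'I_s.+1 -> nat).
Local Notation index := 'I_(\sum_j m j).
Context (alpha : R).

Definition clamp (x : R) : R := Num.min 1 (Num.max 0 x).

Lemma clamp_ge0 x : 0 <= clamp x.
Proof. by rewrite /clamp le_min ler01 le_max lexx. Qed.

Lemma clamp_le1 x : clamp x <= 1.
Proof. by rewrite /clamp ge_min lexx. Qed.

(** The amount x fills unit slots one after the other. *)
Lemma sum_clamp x n : 0 <= x ->
  \sum_(k < n) clamp (x - k%:R) = Num.min n%:R x.
Proof.
move=> x0; elim: n => [|n ih].
  by rewrite big_ord0 min_l.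
rewrite big_ord_recr /= ih -natr1 /clamp.
have [xn|nx] := leP x n%:R; first by rewrite max_l ?subr_le0 // !min_r; lra.
rewrite max_r ?subr_ge0 ?(ltW nx) //.
by have [xn|xn] := leP x (n%:R + 1); [rewrite min_r|rewrite min_l]; lra.
Qed.

Lemma sum_clampN x n : x <= 0 -> \sum_(k < n) clamp (x - k%:R) = 0.
Proof.
move=> x0; rewrite big1 // => k _; rewrite /clamp max_l ?min_r //.
by rewrite subr_le0 (le_trans x0).
Qed.

Lemma dim_uptoS (j : 'I_s.+1) : dim_upto m j.+1 = (dim_upto m j + m j)%N.
Proof.
rewrite /dim_upto (bigD1 j) //= addnC; congr (_ + _)%N.
by apply: eq_bigl => k; rewrite ltnS ltn_neqAle andbC.
Qed.

Lemma dim_upto_mono : {homo dim_upto m : k l / (k <= l)%N}.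
Proof.
move=> k l kl; rewrite /dim_upto big_mkcond [leqRHS]big_mkcond /=.
by apply: leq_sum => j _; case: ifP => // jk; rewrite (leq_trans jk kl).
Qed.

Definition clamped_dim (l : nat) : R := Num.min (dim_upto m l)%:R alpha.

Lemma layer_clamp (j : 'I_s.+1) :
  \sum_(k < m j) clamp (alpha - (dim_upto m j)%:R - k%:R) =
  clamped_dim j.+1 - clamped_dim j.
Proof.
rewrite /clamped_dim dim_uptoS natrD.
have [dj|jd] := leP (dim_upto m j)%:R alpha.
  rewrite sum_clamp ?subr_ge0 //.
  by have [] := leP alpha ((dim_upto m j)%:R + (m j)%:R) => ?;
    [rewrite min_r|rewrite min_l]; lra.
rewrite sum_clampN; last by rewrite subr_le0 ltW.
by rewrite min_r ?subrr // ler_wpDr // ltW.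
Qed.

(** The proportion gamma_i of free digits: each coordinate takes what the preceding ones leave of
    alpha, up to 1. *)
Definition coord_dim (i : index) : R :=
  clamp (alpha - (dim_upto m (tag (tagnat.sig i)))%:R
    - (tagged (tagnat.sig i) : nat)%:R).

Lemma sum_coord_dim (c : 'I_s.+1 -> R) :
  \sum_(i : index) c (tagnat.sig1 i) * coord_dim i =
  \sum_j c j * (clamped_dim j.+1 - clamped_dim j).
Proof.
rewrite (reindex _ (onW_bij _ (@tagnat.rank_bij _ m))) /=.
under [RHS]eq_bigr do rewrite -layer_clamp mulr_sumr.
rewrite (sig_big_dep xpredT (fun _ => xpredT) (fun (j : 'I_s.+1) (k : 'I_(m j)) =>
  c j * clamp (alpha - (dim_upto m j)%:R - k%:R))) /=.
by apply: eq_bigr => p _; rewrite /coord_dim /tagnat.sig1 tagnat.rankK.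
Qed.

Lemma dim_upto0 : dim_upto m 0 = 0%N.
Proof. by rewrite /dim_upto big_pred0. Qed.

Lemma dim_upto_last : dim_upto m s.+1 = edim m.
Proof. by rewrite /dim_upto /edim; apply: eq_bigl => j; rewrite ltn_ord. Qed.

Lemma sum_coord_dim1 : 0 <= alpha -> alpha <= (edim m)%:R ->
  \sum_(i : index) coord_dim i = alpha.
Proof.
move=> alpha0 alpha1.
have E := sum_coord_dim (fun=> 1).
rewrite (eq_bigr (fun i => 1 * coord_dim i)) => [|i _]; last by rewrite mul1r.
rewrite {}E; under eq_bigr do rewrite mul1r.
rewrite -(big_mkord xpredT (fun j => clamped_dim j.+1 - clamped_dim j)).
rewrite telescope_sumr // /clamped_dim dim_upto0 dim_upto_last.
by rewrite min_r // min_l ?subr0.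
Qed.

(** The layers before l are full, the layer l receives the rest of alpha, and the later ones are
    empty. *)
Lemma sum_weight_coord_dim : 0 < alpha -> alpha <= (edim m)%:R ->
  \sum_(i : index) (weight i).+1%:R * coord_dim i = beta_minus m alpha.
Proof.
move=> alpha0 alpha1; rewrite (sum_coord_dim (fun j => j.+1%:R)) /beta_minus.
case: pickP => [l /andP[dl al]|nol]; last first.
  (* The default value of [beta_minus] is excluded: the least such l also satisfies the strict
     inequality. *)
  have ex : exists l, alpha <= (dim_upto m l.+1)%:R.
    by exists s; rewrite dim_upto_last.
  case: (ex_minnP ex) => l al lmin.
  have ls : (l < s.+1)%N by rewrite ltnS lmin // dim_upto_last.
  have := nol (Ordinal ls); rewrite /= al andbT ltNge => /negbFE dl.
  case: l al lmin dl {ls} => [|l] al lmin dl.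
    by move: dl; rewrite dim_upto0 leNgt alpha0.
  by have := lmin _ dl; rewrite ltnn.
rewrite (bigD1 l) //= addrC; congr (_ + _); last first.
  by rewrite /clamped_dim min_r // min_l ?ltW // -natr1 addrC.
rewrite (bigID (fun j : 'I_s.+1 => (j < l)%N)) /= [X in _ + X]big1 ?addr0; last first.
  move=> j /andP[jl]; rewrite -leqNgt => lj.
  have lj' : (l < j)%N by rewrite ltn_neqAle lj andbT eq_sym.
  have alj : alpha <= (dim_upto m j)%:R.
    by apply: (le_trans al); rewrite ler_nat dim_upto_mono.
  rewrite /clamped_dim !min_r ?subrr ?mulr0 //.
  by apply: (le_trans alj); rewrite ler_nat dim_upto_mono.
rewrite /hdim_upto natr_sum; apply: eq_big => [j|j /andP[_ jl]].
  by case: ltnP; rewrite ?andbF // andbT => jl; rewrite neq_ltn jl.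
have dj : (dim_upto m j.+1)%:R <= alpha.
  by apply: le_trans (ltW dl); rewrite ler_nat dim_upto_mono.
rewrite /clamped_dim !min_l //; last first.
  by apply: le_trans dj; rewrite ler_nat dim_upto_mono.
by rewrite dim_uptoS natrD addrC addKr -natrM.
Qed.

(** Among the first q digits, floor(q gamma_i) are free; a digit is free where this count increases,
    by one at most since gamma_i <= 1. The free digits thus have the right proportion at every
    scale. *)
Definition free_count (i : index) (q : nat) : nat := Num.truncn (q%:R * coord_dim i).

Definition free_digit (i : index) (q : nat) : bool :=
  (free_count i q < free_count i q.+1)%N.

Lemma free_count_le i q : (free_count i q)%:R <= q%:R * coord_dim i.
Proof. by rewrite truncn_le mulr_ge0 ?clamp_ge0. Qed.

Lemma free_count_gt i q : q%:R * coord_dim i - 1 <= (free_count i q)%:R.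
Proof. by rewrite lerBlDr natr1 ltW // truncnS_gt. Qed.

Lemma free_countS i q : free_count i q.+1 = (free_count i q + free_digit i q)%N.
Proof.
have le1 : (free_count i q <= free_count i q.+1)%N.
  by apply: le_truncn; rewrite ler_wpM2r ?clamp_ge0 // ler_nat.
have le2 : (free_count i q.+1 <= (free_count i q).+1)%N.
  rewrite -ltnS -(ltr_nat R); apply: (le_lt_trans (free_count_le _ _)).
  rewrite -natr1 mulrDl mul1r -[ltRHS]natr1.
  by apply: ltr_leD; [exact: truncnS_gt|exact: clamp_le1].
by rewrite /free_digit; case: ltnP => /= *; lia.
Qed.

Lemma sum_free_digit i Q : (\sum_(0 <= q < Q) free_digit i q)%N = free_count i Q.
Proof.
elim: Q => [|Q ih]; first by rewrite big_geq // /free_count mul0r truncn0.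
by rewrite big_nat_recr //= ih free_countS.
Qed.

Lemma card_digits Q (P : index -> nat -> bool) :
  #|finset (fun p : index * 'I_Q => P p.1 p.2)| = (\sum_i \sum_(0 <= q < Q) P i q)%N.
Proof.
rewrite cardsE -sum1_card big_mkcond /=.
rewrite [RHS](eq_bigr (fun i => \sum_(q < Q) (if P i q then 1 else 0))%N).
  by rewrite pair_bigA.
by move=> i _; rewrite big_mkord; apply: eq_bigr => q _; case: (P i q).
Qed.

Lemma card_positions n : #|positions free_digit n| =
  (\sum_i free_count i ((weight i).+1 * n))%N.
Proof.
rewrite (card_digits _ (fun i q => (q < (weight i).+1 * n)%N && free_digit i q)).
apply: eq_bigr => i _; rewrite -sum_free_digit.
have wn : ((weight i).+1 * n <= n * s.+1)%N.
  by rewrite mulnC leq_mul // ltnS weight_le.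
rewrite (big_nat_widen _ _ _ _ _ wn) /= [RHS]big_mkcond /=.
by apply: eq_bigr => q _; case: ltnP.
Qed.

(** As h <= n <= (weight i + 1) n, all positions below h occur in every coordinate among those of n
    factors; floor(h gamma_i) of them are free. *)
Lemma card_positions_ge n h : (h <= n)%N ->
  (#|finset (fun p : index * 'I_(n * s.+1) =>
      (p \in positions free_digit n) && (h <= p.2)%N)| + \sum_i free_count i h)%N =
  #|positions free_digit n|.
Proof.
move=> hn; rewrite card_positions.
have -> : finset (fun p : index * 'I_(n * s.+1) =>
      (p \in positions free_digit n) && (h <= p.2)%N) =
    finset (fun p : index * 'I_(n * s.+1) =>
      ((p.2 < (weight p.1).+1 * n)%N && free_digit p.1 p.2) && (h <= p.2)%N).
  by apply/finset.setP => p; rewrite !inE.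
rewrite (card_digits _ (fun i q =>
  ((q < (weight i).+1 * n)%N && free_digit i q) && (h <= q)%N)).
rewrite -big_split /=; apply: eq_bigr => i _; rewrite -!sum_free_digit.
have wn : ((weight i).+1 * n <= n * s.+1)%N.
  by rewrite mulnC leq_mul // ltnS weight_le.
have hw : (h <= (weight i).+1 * n)%N by rewrite (leq_trans hn) // leq_pmull.
rewrite [RHS](big_cat_nat (leq0n h) hw) /= addnC; congr (_ + _)%N.
rewrite [RHS](big_nat_widenl _ 0) // [RHS](big_nat_widen _ _ _ _ _ wn) /=.
rewrite [RHS]big_mkcond /=; apply: eq_bigr => q _.
by case: (q < _)%N; case: (h <= q)%N; case: (free_digit i q).
Qed.

End Dimensions.

(** * Free digits in the proportions gamma_i and the two measure estimates *)

Theorem theorem5p4 (R : realType) (s : nat) (m : 'I_s.+1 -> nat)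
    (G : carnot_group R m) (alpha : R) :
  0 < alpha -> alpha <= (edim m)%:R ->
  exists K : set (coords R m),
    [/\ compact K,
        (0 < hausdorff_measure (@euclidean_dist R s m) alpha K)%E &
        (hausdorff_measure (cc_dist G) (beta_minus m alpha) K < +oo)%E].
Proof.
move=> alpha0 alpha1.
have [rho rho0 tail_le] := tail_product_bound G.
pose free := @free_digit R s m alpha.
have Kc : compact (fractal G free) := compact_fractal tail_le.
have powR2 (k : nat) : (2 ^ k)%:R = 2 `^ k%:R :> R by rewrite powR_mulrn // natrX.
have powR2n (k : nat) (b : R) : (2 ^+ k) `^ b = 2 `^ (k%:R * b).
  by rewrite powRrM powR_mulrn.
exists (fractal G free); split=> //.
(* Rounding loses at most one free digit per coordinate, whence the constant. *)
- apply: (@hausdorff_measure_gt0 _ _ _ _ (2 `^ (edim m)%:R)) => //.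
  move=> x y; rewrite lee_fin; apply: norm_le_coord => [|i]; first exact: sqrtr_ge0.
    rewrite -sqrtr_sqr !mxE; apply: ler_wsqrtr.
    by rewrite (bigD1 i) //= lerDl; apply: sumr_ge0 => j _; exact: sqr_ge0.
  move=> n.
  pose I := {W : {set 'I_(\sum_j m j) * 'I_(n * s.+1)} | W \subset positions free n}.
  exists I.
  exists (fun W => partial_product G (digits_of (val W)) n).
  have cardI : #|{: I}| = (2 ^ #|positions free n|)%N.
    by rewrite card_sig -card_powerset; apply: eq_card => W; rewrite powersetE.
  split; first by rewrite cardI expn_gt0.
    move=> [W WP] /=; apply: subset_closure; exists (digits_of W), n; split=> //.
    by move=> i q /(digits_of_positions WP)/andP[].
  move=> h O hn Osep; rewrite cardI.
  have := card_positions_ge m alpha hn; set H := finset _ => cardH.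
  apply: (@le_trans _ _ (2 ^ #|H|)%:R).
    rewrite ler_nat; apply: leq_trans _ (card_separated G free n Osep).
    rewrite -(card_imset _ val_inj); apply/subset_leq_card/fintype.subsetP => W.
    case/imsetP=> [[W' W'P]] OW' ->; rewrite inE.
    by apply/andP; split; [exact: W'P|exact: OW'].
  have -> : (2^-1 ^+ h) `^ alpha = 2 `^ (- h%:R * alpha) :> R.
    by rewrite exprVn powRrM powRN powR_mulrn.
  rewrite !powR2 -!powRD ?pnatr_eq0 ?implybT // ler_powR ?ler1n //.
  (* The number #|H| of digits left undetermined is that of all free positions minus the sum of the
     floor(h gamma_i), which is at least h alpha - edim m. *)
  rewrite -cardH natrD natr_sum.
  have : \sum_(i < \sum_j m j) (h%:R * coord_dim alpha i - 1) <=
      \sum_(i < \sum_j m j) (free_count alpha i h)%:R.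
    by apply: ler_sum => i _; exact: free_count_gt.
  rewrite sumrB -mulr_sumr sum_coord_dim1 ?(ltW alpha0) // sumr_const card_ord; lra.
have [C C0 ccC] := tile_cc_dist G rho.
apply: (@le_lt_trans _ _ (C `^ beta_minus m alpha)%:E); last by rewrite ltry.
apply: hausdorff_measure_le => //.
- rewrite -sum_weight_coord_dim //; apply: sumr_ge0 => i _.
  by rewrite mulr_ge0 // clamp_ge0.
- exact: cc_dist_ge0.
move=> n; exists {W : {set 'I_(\sum_j m j) * 'I_(n * s.+1)} | W \subset positions free n}.
exists (fun W => tile G rho n (digits_of (val W))); split.
- move=> x /(fractal_cover tail_le n)[W WP Wx].
  by exists (exist _ W WP).
- by move=> W x y; exact: ccC.
rewrite card_sig (eq_card (B := mem (powerset (positions free n)))); last first.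
  by move=> W; rewrite powersetE.
(* The number of tiles is 2 to the power of the sum of the floor(w_i n gamma_i), at most n times the
   sum of the w_i gamma_i, which is beta_-(alpha). *)
rewrite card_powerset powR2 powR2n ler_powR ?ler1n // card_positions natr_sum.
rewrite -sum_weight_coord_dim // mulr_sumr; apply: ler_sum => i _.
by apply: (le_trans (free_count_le _ _ _)); rewrite natrM mulrA [n%:R * _]mulrC.
Qed.
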